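(* Let $D=\left(\frac{a,b}{K}\right)$ be a quaternion division algebra over $K$ with $a,b\in\mathcal{O}_K^*$, with $K$-basis $1,x,y,z$ where $x^2=a$, $y^2=b$, $z=xy=-yx$, and let $\tau$ be its canonical involution. Take $\epsilon=-1$, $\sigma=\tau_x$ and $\pi'=\pi x$, so that $\sigma_{\pi'}=\tau$. Then Larmour's isomorphism $\partial=(\partial_0,\partial_1)$ is an isomorphism $$W^{-1}\left(\left(\tfrac{a,b}{K}\right),\tau_x\right)\cong W^{-1}\left(\left(\tfrac{\overline a,\overline b}{k}\right),\overline{\tau_x}\right)\oplus W^{1}\left(\left(\tfrac{\overline a,\overline b}{k}\right),\overline{\tau}\right),$$ and on one-dimensional forms it is given as follows. For $\alpha\in\mathcal{O}_K^*$, the image of the unramified skew-hermitian form $\langle\alpha x\rangle$ under $\partial_0$ is $\langle\overline\alpha\,\overline x\rangle$. For $\alpha\in K$ with $\nu_K(\alpha)=1$, the image of the ramified skew-hermitian form $\langle\alpha x\rangle$ under $\partial_1$ is $\langle\overline{\pi^{-1}\alpha}\rangle$.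
   Context: $K$ is a complete discretely valued field with normalized valuation $\nu_K$, valuation ring $\mathcal{O}_K$, uniformizer $\pi$ and residue field $k$ of characteristic $\neq2$. $\nu_D(d)=\frac12\nu_K(\mathrm{Nrd}(d))$ extends $\nu_K$ to $D$; $\mathcal{O}_D=\{\nu_D\ge0\}$, $m_D=\{\nu_D>0\}$ (both with $0$), $\overline D=\mathcal{O}_D/m_D$, and a bar denotes reduction modulo $m_D$. When $a,b$ are units, $\overline D\cong\left(\frac{\overline a,\overline b}{k}\right)$, a quaternion division algebra, and $\nu_D$ has value group $\mathbb{Z}$. Every $K$-linear involution $\sigma$ of $D$ preserves $\mathcal{O}_D,m_D$ and induces $\overline\sigma$ on $\overline D$. $\tau(x)=-x$, $\tau(y)=-y$, $\tau(z)=-z$. For $\lambda\in D^*$, $\sigma_\lambda(d)=\lambda\sigma(d)\lambda^{-1}$. $W^\epsilon(E,\rho)$ is the Witt group of nondegenerate $\epsilon$-hermitian forms over a division algebra with involution $(E,\rho)$, and $\langle u_1,\dots,u_r\rangle$ is the diagonal form with $\rho(u_i)=\epsilon u_i$. Larmour's isomorphism: given an $\epsilon$-symmetric uniformizer $\pi'$ of $D$ (i.e. $\sigma(\pi')=\epsilon\pi'$ and $\nu_D(\pi')$ is the least positive value of $\nu_D$), every $\epsilon$-hermitian form over $(D,\sigma)$ is isometric to $h_0\perp h_1$ with $h_0=\langle u_1,\dots,u_p\rangle$, $\nu_D(u_i)=0$ (unramified), and $h_1=\langle v_1,\dots,v_q\rangle$, $\nu_D(v_i)=\nu_D(\pi')$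 (ramified). Set $\overline{h_0}=\langle\overline{u_1},\dots,\overline{u_p}\rangle$ and $\overline{h_1}=\langle\overline{v_1\pi'^{-1}},\dots,\overline{v_q\pi'^{-1}}\rangle$. Then $\partial:W^\epsilon(D,\sigma)\to W^\epsilon(\overline D,\overline\sigma)\oplus W^1(\overline D,\overline{\sigma_{\pi'}})$, $[h]\mapsto([\overline{h_0}],[\overline{h_1}])$, is Larmour's (well-defined) group isomorphism. *)

(* Defs.v *)
From HB Require Import structures.
From mathcomp Require Import all_boot all_order all_algebra ring.
From mathcomp Require Import boolp.

Set Implicit Arguments.
Unset Strict Implicit.
Unset Printing Implicit Defensive.

Import Order.TTheory GRing.Theory Num.Theory.
Local Open Scope ring_scope.
Local Open Scope quotient_scope.

(* A valuation is represented by a function [v] whose value at 0 is junk; only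
   the values at nonzero elements are ever used, and 0 (of valuation +oo) is
   added by hand wherever it belongs. *)

Definition val_ring (R : nzRingType) (V : numDomainType) (v : R -> V) (d : R)
  : Prop := d = 0 \/ 0 <= v d.

Definition val_ideal (R : nzRingType) (V : numDomainType) (v : R -> V) (d : R)
  : Prop := d = 0 \/ 0 < v d.

Record complete_discrete_valuation (K : fieldType) (nu : K -> int) : Prop := {
  cdv_mul : forall c d, c != 0 -> d != 0 -> nu (c * d) = nu c + nu d;
  cdv_add : forall c d, c != 0 -> d != 0 -> c + d != 0 ->
    Num.min (nu c) (nu d) <= nu (c + d);
  cdv_normalized : exists2 c, c != 0 & nu c = 1;
  cdv_complete : forall s : nat -> K,
    (forall N : int, exists M : nat, forall i j : nat, (M <= i)%N -> (M <= j)%N ->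
       s i - s j = 0 \/ N <= nu (s i - s j)) ->
    exists l : K, forall N : int, exists M : nat, forall i : nat, (M <= i)%N ->
       s i - l = 0 \/ N <= nu (s i - l) }.

(* [red] restricts to a surjective ring morphism from the valuation ring
   {v >= 0} of [R] onto [S] with kernel {v > 0}, i.e., it identifies [S] with
   {v >= 0} / {v > 0}; the values of [red] outside {v >= 0} are junk. *)
Record residue_map (R S : nzRingType) (V : numDomainType) (v : R -> V)
    (red : R -> S) : Prop := {
  residue_1 : red 1 = 1;
  residue_ring : forall c d, val_ring v c -> val_ring v d ->
    [/\ val_ring v (c - d), val_ring v (c * d),
        red (c - d) = red c - red d & red (c * d) = red c * red d];
  residue_ker : forall d, val_ring v d -> (red d = 0 <-> val_ideal v d);
  residue_surj : forall e, exists2 d, val_ring v d & red d = e }.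

(* [Quat p0 p1 p2 p3] is p0 + p1 x + p2 y + p3 z in the algebra (a, b / K), where
   x^2 = a, y^2 = b and z = x y = - y x. *)
Record quat (K : fieldType) (a b : K) : Type :=
  Quat { q0 : K; q1 : K; q2 : K; q3 : K }.
Arguments Quat {K a b}.

Section QuatTheory.
Variables (K : fieldType) (a b : K).
Local Notation H := (quat a b).

Lemma quat_eq (p q : H) : q0 p = q0 q -> q1 p = q1 q -> q2 p = q2 q ->
  q3 p = q3 q -> p = q.
Proof. by case: p q => [? ? ? ?] [? ? ? ?] /= -> -> -> ->. Qed.

Definition quat_to_prod (p : H) := (q0 p, q1 p, q2 p, q3 p).
Definition quat_of_prod (t : K * K * K * K) : H :=
  let: (t0, t1, t2, t3) := t in Quat t0 t1 t2 t3.
Lemma quat_to_prodK : cancel quat_to_prod quat_of_prod.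
Proof. by case. Qed.

HB.instance Definition _ := Choice.copy H (can_type quat_to_prodK).

Definition quat_zero : H := Quat 0 0 0 0.
Definition quat_add (p q : H) : H :=
  Quat (q0 p + q0 q) (q1 p + q1 q) (q2 p + q2 q) (q3 p + q3 q).
Definition quat_opp (p : H) : H := Quat (- q0 p) (- q1 p) (- q2 p) (- q3 p).

Fact quat_addA : associative quat_add.
Proof. by move=> p q r; apply: quat_eq => /=; ring. Qed.
Fact quat_addC : commutative quat_add.
Proof. by move=> p q; apply: quat_eq => /=; ring. Qed.
Fact quat_add0 : left_id quat_zero quat_add.
Proof. by move=> p; apply: quat_eq => /=; ring. Qed.
Fact quat_addN : left_inverse quat_zero quat_opp quat_add.
Proof. by move=> p; apply: quat_eq => /=; ring. Qed.

HB.instance Definition _ :=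
  GRing.isZmodule.Build H quat_addA quat_addC quat_add0 quat_addN.

Definition quat_one : H := Quat 1 0 0 0.
Definition quat_mul (p q : H) : H :=
  Quat (q0 p * q0 q + a * (q1 p * q1 q) + b * (q2 p * q2 q)
          - a * b * (q3 p * q3 q))
       (q0 p * q1 q + q1 p * q0 q - b * (q2 p * q3 q) + b * (q3 p * q2 q))
       (q0 p * q2 q + q2 p * q0 q + a * (q1 p * q3 q) - a * (q3 p * q1 q))
       (q0 p * q3 q + q3 p * q0 q + q1 p * q2 q - q2 p * q1 q).

Fact quat_mulA : associative quat_mul.
Proof. by move=> p q r; apply: quat_eq => /=; ring. Qed.
Fact quat_mul1l : left_id quat_one quat_mul.
Proof. by move=> p; apply: quat_eq => /=; ring. Qed.
Fact quat_mul1r : right_id quat_one quat_mul.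
Proof. by move=> p; apply: quat_eq => /=; ring. Qed.
Fact quat_mulDl : left_distributive quat_mul quat_add.
Proof. by move=> p q r; apply: quat_eq => /=; ring. Qed.
Fact quat_mulDr : right_distributive quat_mul quat_add.
Proof. by move=> p q r; apply: quat_eq => /=; ring. Qed.
Fact quat_one_neq0 : quat_one != 0.
Proof. by apply/eqP => -[] /eqP; rewrite oner_eq0. Qed.

HB.instance Definition _ := GRing.Zmodule_isNzRing.Build H
  quat_mulA quat_mul1l quat_mul1r quat_mulDl quat_mulDr quat_one_neq0.

Definition quat_scale (c : K) (p : H) : H :=
  Quat (c * q0 p) (c * q1 p) (c * q2 p) (c * q3 p).

Fact quat_scaleA c d p :
  quat_scale c (quat_scale d p) = quat_scale (c * d) p.
Proof. by apply: quat_eq => /=; ring. Qed.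
Fact quat_scale1 : left_id 1 quat_scale.
Proof. by move=> p; apply: quat_eq => /=; ring. Qed.
Fact quat_scaleDr : right_distributive quat_scale +%R.
Proof. by move=> c p q; apply: quat_eq => /=; ring. Qed.
Fact quat_scaleDl p : {morph quat_scale^~ p : c d / c + d}.
Proof. by move=> c d; apply: quat_eq => /=; ring. Qed.

HB.instance Definition _ := GRing.Zmodule_isLmodule.Build K H
  quat_scaleA quat_scale1 quat_scaleDr quat_scaleDl.

Fact quat_scaleAl (c : K) (p q : H) : c *: (p * q) = c *: p * q.
Proof. by apply: quat_eq => /=; ring. Qed.
HB.instance Definition _ := GRing.Lmodule_isLalgebra.Build K H quat_scaleAl.

Fact quat_scaleAr (c : K) (p q : H) : c *: (p * q) = p * (c *: q).
Proof. by apply: quat_eq => /=; ring. Qed.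
HB.instance Definition _ := GRing.Lalgebra_isAlgebra.Build K H quat_scaleAr.

Definition quat_x : H := Quat 0 1 0 0.
Definition quat_y : H := Quat 0 0 1 0.
Definition quat_z : H := Quat 0 0 0 1.

Lemma quat_xx : quat_x * quat_x = a%:A.
Proof. by apply: quat_eq => /=; ring. Qed.
Lemma quat_yy : quat_y * quat_y = b%:A.
Proof. by apply: quat_eq => /=; ring. Qed.
Lemma quat_xy : quat_x * quat_y = quat_z.
Proof. by apply: quat_eq => /=; ring. Qed.
Lemma quat_yx : quat_y * quat_x = - quat_z.
Proof. by apply: quat_eq => /=; ring. Qed.
Lemma quatE (p : H) :
  p = (q0 p)%:A + q1 p *: quat_x + q2 p *: quat_y + q3 p *: quat_z.
Proof. by apply: quat_eq => /=; ring. Qed.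

Definition quat_tau (p : H) : H := Quat (q0 p) (- q1 p) (- q2 p) (- q3 p).

Fact quat_tau_zmod : zmod_morphism quat_tau.
Proof. by move=> p q; apply: quat_eq => /=; ring. Qed.
HB.instance Definition _ := GRing.isZmodMorphism.Build H H quat_tau quat_tau_zmod.

Definition Nrd (p : H) : K :=
  q0 p ^+ 2 - a * q1 p ^+ 2 - b * q2 p ^+ 2 + a * b * q3 p ^+ 2.

Lemma NrdE (p : H) : p * quat_tau p = (Nrd p)%:A.
Proof. by apply: quat_eq; rewrite /Nrd /=; ring. Qed.
Lemma NrdEl (p : H) : quat_tau p * p = (Nrd p)%:A.
Proof. by apply: quat_eq; rewrite /Nrd /=; ring. Qed.
Lemma Nrd_mul (p q : H) : Nrd (p * q) = Nrd p * Nrd q.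
Proof. by rewrite /Nrd /=; ring. Qed.
Lemma Nrd1 : Nrd 1 = 1.
Proof. by rewrite /Nrd /=; ring. Qed.

Definition quat_unit : pred H := fun p => Nrd p != 0.
Definition quat_inv (p : H) : H :=
  if quat_unit p then (Nrd p)^-1 *: quat_tau p else p.

Fact quat_mulVr : {in quat_unit, left_inverse 1 quat_inv *%R}.
Proof.
move=> p; rewrite -[p \in _]/(quat_unit p) => up; rewrite /quat_inv up.
by rewrite -scalerAl NrdEl scalerA mulVf // scale1r.
Qed.
Fact quat_mulrV : {in quat_unit, right_inverse 1 quat_inv *%R}.
Proof.
move=> p; rewrite -[p \in _]/(quat_unit p) => up; rewrite /quat_inv up.
by rewrite -scalerAr NrdE scalerA mulVf // scale1r.
Qed.
Fact quat_unitP (p q : H) : q * p = 1 /\ p * q = 1 -> quat_unit p.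
Proof.
case=> /(congr1 Nrd); rewrite Nrd_mul Nrd1 => e _; apply/eqP => p0.
by move/eqP: e; rewrite p0 mulr0 eq_sym oner_eq0.
Qed.
Fact quat_invr_out : {in [predC quat_unit], quat_inv =1 id}.
Proof.
move=> p; rewrite inE /= -[p \in _]/(quat_unit p) /quat_inv => /negbTE up.
by rewrite up.
Qed.

HB.instance Definition _ := GRing.NzRing_hasMulInverse.Build H
  quat_mulVr quat_mulrV quat_unitP quat_invr_out.

End QuatTheory.

Arguments quat_x {K}.
Arguments quat_y {K}.
Arguments quat_z {K}.
Arguments quat_tau {K}.

Definition nuD (K : fieldType) (nu : K -> int) (a b : K) (d : quat a b) : rat :=
  (nu (Nrd d))%:~R / 2%:R.

(* When a and b are units, the residue characteristic is not 2 and (a, b / K) is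
   a division algebra over a complete K, this is reduction modulo {nuD > 0}. *)
Definition quat_red (K k : fieldType) (res : K -> k) (a b : K) (d : quat a b)
  : quat (res a) (res b) :=
  Quat (res (q0 d)) (res (q1 d)) (res (q2 d)) (res (q3 d)).

Definition conj_inv (E : unitRingType) (sigma : {additive E -> E}) (l : E)
  : E -> E := fun d => l * sigma d * l^-1.

Section ConjInv.
Variables (E : unitRingType) (sigma : {additive E -> E}) (l : E).
Fact conj_inv_zmod : zmod_morphism (conj_inv sigma l).
Proof. by move=> c d; rewrite /conj_inv raddfB mulrBr mulrBl. Qed.
HB.instance Definition _ :=
  GRing.isZmodMorphism.Build E E (conj_inv sigma l) conj_inv_zmod.
End ConjInv.

Definition tau_x (K : fieldType) (a b : K) : {additive quat a b -> quat a b} :=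
  conj_inv (quat_tau a b) (quat_x a b).
Arguments tau_x {K}.

Definition is_involution (E : nzRingType) (rho : E -> E) : Prop :=
  [/\ zmod_morphism rho, rho 1 = 1, {morph rho : c d / c * d >-> d * c}
    & involutive rho].

Lemma quat_tau_involution (K : fieldType) (a b : K) :
  is_involution (@quat_tau K a b).
Proof.
split; first exact: quat_tau_zmod.
- by apply: quat_eq => /=; ring.
- by move=> p q; apply: quat_eq => /=; ring.
- by move=> p; apply: quat_eq => /=; ring.
Qed.

Lemma conj_inv_involution (E : unitRingType) (sigma : {additive E -> E}) (l : E) :
  is_involution sigma -> l \is a GRing.unit -> sigma l = l \/ sigma l = - l ->
  is_involution (conj_inv sigma l).
Proof.
case=> _ s1 sM sK ul sl; split; first exact: conj_inv_zmod.
- by rewrite /conj_inv s1 mulr1 mulrV.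
- by move=> c d; rewrite /conj_inv sM !mulrA mulrVK.
- have usl : sigma l \is a GRing.unit by case: sl => -> //; rewrite unitrN.
  have slV : sigma l^-1 = (sigma l)^-1.
    by apply: (mulIr usl); rewrite mulVr // -sM mulrV.
  move=> d; rewrite /conj_inv !sM sK slV !mulrA.
  case: sl => ->; first by rewrite mulrV // mul1r mulrK.
  by rewrite invrN !(mulrN, mulNr) opprK mulrV // mul1r mulrK.
Qed.

(* Forms live on the left E-spaces E^n of row vectors, which makes h p^-1
   sesquilinear for conj_inv rho p. Turning left spaces into right ones through
   rho does not change the diagonal notation <u_1, ..., u_n>. *)
Record hform (E : nzRingType) (rho : {additive E -> E}) (eps : E) (n : nat) :=
  Form {
    form_fun :> 'rV[E]_n -> 'rV[E]_n -> E;
    form_linl : forall c u u' v,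
      form_fun (c *: u + u') v = c * form_fun u v + form_fun u' v;
    form_linr : forall c u v v',
      form_fun u (c *: v + v') = form_fun u v * rho c + form_fun u v';
    form_herm : forall u v, form_fun v u = eps * rho (form_fun u v);
    form_nondeg : forall v, (forall u, form_fun u v = 0) -> v = 0 }.

(* [diagonal h u] says that [h] is the form <u_1, ..., u_n>. *)
Definition diagonal (E : nzRingType) (rho : {additive E -> E}) (eps : E) (n : nat)
    (h : hform rho eps n) (u : 'I_n -> E) : Prop :=
  forall v w : 'rV[E]_n, h v w = \sum_(i < n) v 0 i * u i * rho (w 0 i).

Section Forms.
Variables (E : nzRingType) (rho : {additive E -> E}) (eps : E).
Local Notation form := (hform rho eps).

Definition isometric n m (h : form n) (g : form m) : Prop :=
  exists2 f : {linear 'rV[E]_n -> 'rV[E]_m},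
    bijective f & forall u v, g (f u) (f v) = h u v.

Lemma formDl n (h : form n) u u' v : h (u + u') v = h u v + h u' v.
Proof. by rewrite -{1}[u]scale1r form_linl mul1r. Qed.
Lemma form0l n (h : form n) v : h 0 v = 0.
Proof. by apply: (addrI (h 0 v)); rewrite -formDl !addr0. Qed.
Lemma formNl n (h : form n) u v : h (- u) v = - h u v.
Proof. by apply: (addrI (h u v)); rewrite -formDl !subrr form0l. Qed.
Lemma form_sym0 n (h : form n) u v : h u v = 0 -> h v u = 0.
Proof. by rewrite (form_herm h u v) => ->; rewrite raddf0 mulr0. Qed.
Lemma form0r n (h : form n) v : h v 0 = 0.
Proof. exact/form_sym0/form0l. Qed.
Lemma formDr n (h : form n) u v v' : h u (v + v') = h u v + h u v'.
Proof.
by rewrite (form_herm h _ u) formDl raddfD mulrDr -!form_herm.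
Qed.
Lemma formNr n (h : form n) u v : h u (- v) = - h u v.
Proof. by apply: (addrI (h u v)); rewrite -formDr !subrr form0r. Qed.

Section OrthogonalSum.
Variables (n m : nat) (h : form n) (g : form m).
Definition osum_fun (u v : 'rV[E]_(n + m)) : E :=
  h (lsubmx u) (lsubmx v) + g (rsubmx u) (rsubmx v).
Fact osum_linl c u u' v :
  osum_fun (c *: u + u') v = c * osum_fun u v + osum_fun u' v.
Proof. by rewrite /osum_fun !linearP /= !form_linl mulrDr addrACA. Qed.
Fact osum_linr c u v v' :
  osum_fun u (c *: v + v') = osum_fun u v * rho c + osum_fun u v'.
Proof. by rewrite /osum_fun !linearP /= !form_linr mulrDl addrACA. Qed.
Fact osum_herm u v : osum_fun v u = eps * rho (osum_fun u v).
Proof. by rewrite /osum_fun raddfD mulrDr -!form_herm. Qed.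
Fact osum_nondeg v : (forall u, osum_fun u v = 0) -> v = 0.
Proof.
move=> hv; have hl : lsubmx v = 0.
  apply: (form_nondeg (h := h)) => u; have := hv (row_mx u 0).
  by rewrite /osum_fun row_mxKl row_mxKr form0l addr0.
have hr : rsubmx v = 0.
  apply: (form_nondeg (h := g)) => u; have := hv (row_mx 0 u).
  by rewrite /osum_fun row_mxKl row_mxKr form0l add0r.
by rewrite -[v]hsubmxK hl hr row_mx0.
Qed.
Definition osum : form (n + m) :=
  Form osum_linl osum_linr osum_herm osum_nondeg.
End OrthogonalSum.

Section Opposite.
Variables (n : nat) (h : form n).
Definition oppf_fun (u v : 'rV[E]_n) : E := - h u v.
Fact oppf_linl c u u' v :
  oppf_fun (c *: u + u') v = c * oppf_fun u v + oppf_fun u' v.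
Proof. by rewrite /oppf_fun form_linl opprD mulrN. Qed.
Fact oppf_linr c u v v' :
  oppf_fun u (c *: v + v') = oppf_fun u v * rho c + oppf_fun u v'.
Proof. by rewrite /oppf_fun form_linr opprD mulNr. Qed.
Fact oppf_herm u v : oppf_fun v u = eps * rho (oppf_fun u v).
Proof. by rewrite /oppf_fun raddfN mulrN -form_herm. Qed.
Fact oppf_nondeg v : (forall u, oppf_fun u v = 0) -> v = 0.
Proof.
by move=> hv; apply: (form_nondeg (h := h)) => u; apply/oppr_inj; rewrite oppr0; apply: hv.
Qed.
Definition oppf : form n := Form oppf_linl oppf_linr oppf_herm oppf_nondeg.
End Opposite.

Section ZeroForm.
Definition zerof_fun (u v : 'rV[E]_0) : E := 0.
Fact zerof_linl c u u' v :
  zerof_fun (c *: u + u') v = c * zerof_fun u v + zerof_fun u' v.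
Proof. by rewrite /zerof_fun mulr0 addr0. Qed.
Fact zerof_linr c u v v' :
  zerof_fun u (c *: v + v') = zerof_fun u v * rho c + zerof_fun u v'.
Proof. by rewrite /zerof_fun mul0r addr0. Qed.
Fact zerof_herm u v : zerof_fun v u = eps * rho (zerof_fun u v).
Proof. by rewrite /zerof_fun raddf0 mulr0. Qed.
Fact zerof_nondeg v : (forall u, zerof_fun u v = 0) -> v = 0.
Proof. by move=> _; apply: thinmx0. Qed.
Definition zerof : form 0 := Form zerof_linl zerof_linr zerof_herm zerof_nondeg.
End ZeroForm.

(* [h] has a Lagrangian, i.e., a subspace L equal to its own orthogonal. Over a
   division ring of characteristic not 2 this is equivalent to being
   hyperbolic. *)
Definition metabolic n (h : form n) : Prop :=
  exists2 L : 'rV[E]_n -> Prop,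
    L 0 /\ (forall c u v, L u -> L v -> L (c *: u + v))
  & forall v, L v <-> (forall u, L u -> h u v = 0).

Definition witt_rel n m (h : form n) (g : form m) : Prop :=
  exists p q (M : form p) (N : form q),
    [/\ metabolic M, metabolic N & isometric (osum h M) (osum g N)].

Lemma isometric_refl n (h : form n) : isometric h h.
Proof. by exists idfun => //; exists id. Qed.

Lemma isometric_sym n m (h : form n) (g : form m) :
  isometric h g -> isometric g h.
Proof.
case=> f [f' fK f'K] fh.
have f'l : linear f'.
  by move=> c u v; apply: (can_inj fK); rewrite f'K linearP !f'K.
pose F : {linear 'rV[E]_m -> 'rV[E]_n} :=
  HB.pack f' (GRing.isLinear.Build _ _ _ _ f' f'l).
exists F; first by exists f.
by move=> u v; rewrite -fh /= !f'K.
Qed.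

Lemma isometric_trans n m p (h : form n) (g : form m) (k : form p) :
  isometric h g -> isometric g k -> isometric h k.
Proof.
move=> [f fb fh] [f' f'b f'h]; exists (f' \o f).
  exact: bij_comp.
by move=> u v; rewrite /= f'h fh.
Qed.

Lemma isometricI n m (h : form n) (g : form m)
    (f : 'rV[E]_n -> 'rV[E]_m) (f' : 'rV[E]_m -> 'rV[E]_n) :
  linear f -> cancel f f' -> cancel f' f ->
  (forall u v, g (f u) (f v) = h u v) -> isometric h g.
Proof.
move=> fl fK f'K fh.
pose F : {linear 'rV[E]_n -> 'rV[E]_m} :=
  HB.pack f (GRing.isLinear.Build _ _ _ _ f fl).
by exists F => //; exists f'.
Qed.

Lemma osumC n m (h : form n) (g : form m) : isometric (osum h g) (osum g h).
Proof.
apply: (@isometricI _ _ _ _ (fun u => row_mx (rsubmx u) (lsubmx u))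
                            (fun u => row_mx (rsubmx u) (lsubmx u))).
- by move=> c u v; rewrite !linearP /= scale_row_mx add_row_mx.
- by move=> u; rewrite row_mxKl row_mxKr hsubmxK.
- by move=> u; rewrite row_mxKl row_mxKr hsubmxK.
- by move=> u v; rewrite /= /osum_fun !(row_mxKl, row_mxKr) addrC.
Qed.

Lemma osumA n m p (h : form n) (g : form m) (k : form p) :
  isometric (osum h (osum g k)) (osum (osum h g) k).
Proof.
apply: (@isometricI _ _ _ _
  (fun u => row_mx (row_mx (lsubmx u) (lsubmx (rsubmx u))) (rsubmx (rsubmx u)))
  (fun u => row_mx (lsubmx (lsubmx u)) (row_mx (rsubmx (lsubmx u)) (rsubmx u)))).
- by move=> c u v; rewrite !linearP /= !scale_row_mx !add_row_mx.
- by move=> u; rewrite !(row_mxKl, row_mxKr) !hsubmxK.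
- by move=> u; rewrite !(row_mxKl, row_mxKr) !hsubmxK.
- by move=> u v; rewrite /= /osum_fun /= /osum_fun !(row_mxKl, row_mxKr) addrA.
Qed.

Lemma osum_iso n m n' m' (h : form n) (g : form m) (h' : form n') (g' : form m') :
  isometric h h' -> isometric g g' -> isometric (osum h g) (osum h' g').
Proof.
move=> [f [f1 fK f1K] fh] [e [e1 eK e1K] eg].
apply: (@isometricI _ _ _ _
  (fun u => row_mx (f (lsubmx u)) (e (rsubmx u)))
  (fun u => row_mx (f1 (lsubmx u)) (e1 (rsubmx u)))).
- by move=> c u v; rewrite !linearP /= scale_row_mx add_row_mx.
- by move=> u; rewrite !(row_mxKl, row_mxKr) fK eK hsubmxK.
- by move=> u; rewrite !(row_mxKl, row_mxKr) f1K e1K hsubmxK.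
- by move=> u v; rewrite /= /osum_fun !(row_mxKl, row_mxKr) fh eg.
Qed.

Lemma osum0 n (h : form n) : isometric (osum zerof h) h.
Proof.
apply: (@isometricI _ _ _ _ (fun u => rsubmx u) (fun u => row_mx 0 u)).
- by move=> c u v; rewrite linearP.
- by move=> u; rewrite -[0](thinmx0 (lsubmx u)) hsubmxK.
- by move=> u; rewrite row_mxKr.
- by move=> u v; rewrite /= /osum_fun add0r.
Qed.

Lemma osumACA n1 n2 n3 n4 (h1 : form n1) (h2 : form n2) (h3 : form n3) (h4 : form n4) :
  isometric (osum (osum h1 h2) (osum h3 h4)) (osum (osum h1 h3) (osum h2 h4)).
Proof.
apply: (@isometricI _ _ _ _
  (fun u => row_mx (row_mx (lsubmx (lsubmx u)) (lsubmx (rsubmx u)))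
                   (row_mx (rsubmx (lsubmx u)) (rsubmx (rsubmx u))))
  (fun u => row_mx (row_mx (lsubmx (lsubmx u)) (lsubmx (rsubmx u)))
                   (row_mx (rsubmx (lsubmx u)) (rsubmx (rsubmx u))))).
- by move=> c u v; rewrite !linearP /= !scale_row_mx !add_row_mx.
- by move=> u; rewrite !(row_mxKl, row_mxKr) !hsubmxK.
- by move=> u; rewrite !(row_mxKl, row_mxKr) !hsubmxK.
- by move=> u v; rewrite /= /osum_fun /= /osum_fun !(row_mxKl, row_mxKr) addrACA.
Qed.

Lemma metabolic0 : metabolic zerof.
Proof. by exists (fun=> True) => //; split. Qed.

Lemma metabolic_osum n m (h : form n) (g : form m) :
  metabolic h -> metabolic g -> metabolic (osum h g).
Proof.
move=> [L [L0 Ll] Lh] [M [M0 Ml] Mg].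
exists (fun u => L (lsubmx u) /\ M (rsubmx u)).
  split; first by rewrite !linear0.
  by move=> c u v [? ?] [? ?]; rewrite !linearP /=; split; [apply: Ll|apply: Ml].
move=> v; split=> [[Lv Mv] u [Lu Mu]|hv].
  by rewrite /= /osum_fun (proj1 (Lh _) Lv) // (proj1 (Mg _) Mv) // addr0.
split; [apply/Lh => u Lu|apply/Mg => u Mu].
  have := hv (row_mx u 0); rewrite /= /osum_fun row_mxKl row_mxKr form0l addr0.
  by apply.
have := hv (row_mx 0 u); rewrite /= /osum_fun row_mxKl row_mxKr form0l add0r.
by apply.
Qed.

Lemma metabolic_opp n (h : form n) : metabolic (osum (oppf h) h).
Proof.
exists (fun u => lsubmx u = rsubmx u).
  by split; [rewrite !linear0|move=> c u v; rewrite !linearP /= => -> ->].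
move=> v; split=> [ev u eu|hv]; first by rewrite /= /osum_fun /= /oppf_fun eu ev addNr.
apply/eqP; rewrite eq_sym -subr_eq0; apply/eqP.
apply: (form_nondeg (h := h)) => u.
have := hv (row_mx u u); rewrite /= /osum_fun /= /oppf_fun row_mxKl row_mxKr.
by move/(_ erefl) => e; rewrite formDr formNr addrC.
Qed.

Lemma witt_rel_iso n m (h : form n) (g : form m) : isometric h g -> witt_rel h g.
Proof.
move=> hg; exists 0, 0, zerof, zerof; split; try exact: metabolic0.
exact: (osum_iso hg (isometric_refl _)).
Qed.

Lemma witt_rel_refl n (h : form n) : witt_rel h h.
Proof. exact/witt_rel_iso/isometric_refl. Qed.

Lemma witt_rel_sym n m (h : form n) (g : form m) : witt_rel h g -> witt_rel g h.
Proof.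
by case=> p [q [M [N [mM mN i]]]]; exists q, p, N, M; split=> //; apply: isometric_sym.
Qed.

Lemma witt_rel_trans n m p (h : form n) (g : form m) (k : form p) :
  witt_rel h g -> witt_rel g k -> witt_rel h k.
Proof.
case=> p1 [q1 [M1 [N1 [mM1 mN1 i1]]]] [p2 [q2 [M2 [N2 [mM2 mN2 i2]]]]].
exists _, _, (osum M1 M2), (osum N2 N1); split; try exact: metabolic_osum.
apply: (isometric_trans (osumA _ _ _)).
apply: (isometric_trans (osum_iso i1 (isometric_refl _))).
apply: (isometric_trans (isometric_sym (osumA _ _ _))).
apply: (isometric_trans (osum_iso (isometric_refl _) (osumC _ _))).
apply: (isometric_trans (osumA _ _ _)).
apply: (isometric_trans (osum_iso i2 (isometric_refl _))).
exact: (isometric_sym (osumA _ _ _)).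
Qed.

Lemma witt_rel_osum n m n' m' (h : form n) (g : form m) (h' : form n') (g' : form m') :
  witt_rel h h' -> witt_rel g g' -> witt_rel (osum h g) (osum h' g').
Proof.
case=> p1 [q1 [M1 [N1 [mM1 mN1 i1]]]] [p2 [q2 [M2 [N2 [mM2 mN2 i2]]]]].
exists _, _, (osum M1 M2), (osum N1 N2); split; try exact: metabolic_osum.
apply: (isometric_trans (osumACA _ _ _ _)).
apply: (isometric_trans (osum_iso i1 i2)).
exact: osumACA.
Qed.

Lemma witt_rel_metabolic n (h : form n) : metabolic h -> witt_rel h zerof.
Proof.
move=> mh; exists 0, n, zerof, h; split=> //; first exact: metabolic0.
exact: osumC.
Qed.

Lemma witt_rel_opp n m (h : form n) (g : form m) :
  witt_rel h g -> witt_rel (oppf h) (oppf g).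
Proof.
move=> hg.
have z k (f : form k) : witt_rel (osum zerof f) f by exact/witt_rel_iso/osum0.
have c k l (f : form k) (f' : form l) : witt_rel (osum f f') (osum f' f).
  exact/witt_rel_iso/osumC.
have a k l r (f : form k) (f' : form l) (f'' : form r) :
    witt_rel (osum f (osum f' f'')) (osum (osum f f') f'').
  exact/witt_rel_iso/osumA.
have o k (f : form k) : witt_rel (osum (oppf f) f) zerof.
  exact/witt_rel_metabolic/metabolic_opp.
apply: (witt_rel_trans (witt_rel_sym (z _ _))).
apply: (witt_rel_trans (witt_rel_osum (witt_rel_sym (o _ g)) (witt_rel_refl _))).
apply: (witt_rel_trans (witt_rel_sym (a _ _ _ _ _ _))).
apply: (@witt_rel_trans _ _ _ _ (osum (oppf g) zerof)).
  apply: witt_rel_osum; first exact: witt_rel_refl.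
  apply: (witt_rel_trans (witt_rel_osum (witt_rel_sym hg) (witt_rel_refl _))).
  exact: witt_rel_trans (c _ _ _ _) (o _ _).
exact: witt_rel_trans (c _ _ _ _) (z _ _).
Qed.

Definition anyform : Type := {n : nat & form n}.
HB.instance Definition _ := gen_eqMixin anyform.
HB.instance Definition _ := gen_choiceMixin anyform.

Definition witt_eq (h g : anyform) : bool := `[< witt_rel (projT2 h) (projT2 g) >].

Fact witt_eq_refl : reflexive witt_eq.
Proof. by move=> h; apply/asboolP/witt_rel_refl. Qed.
Fact witt_eq_sym : symmetric witt_eq.
Proof.
by move=> h g; apply/asboolP/asboolP => /witt_rel_sym.
Qed.
Fact witt_eq_trans : transitive witt_eq.
Proof.
by move=> g h k /asboolP hg /asboolP gk; apply/asboolP/(witt_rel_trans hg gk).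
Qed.
Canonical witt_equiv := EquivRel witt_eq witt_eq_refl witt_eq_sym witt_eq_trans.

End Forms.

(* The Witt group W^eps(E, rho). It is only meant for [E] a division ring,
   [rho] an involution and [eps] equal to 1 or -1, but none of this is needed
   to construct it. *)
Definition witt (E : nzRingType) (rho : {additive E -> E}) (eps : E) : Type :=
  {eq_quot (witt_equiv rho eps)}.

Section WittGroup.
Variables (E : nzRingType) (rho : {additive E -> E}) (eps : E).
Local Notation form := (hform rho eps).
Local Notation W := (witt rho eps).
HB.instance Definition _ := Choice.on W.
HB.instance Definition _ := EqQuotient.on W.

Definition witt_class n (h : form n) : W := \pi_W (existT _ n h).

Lemma witt_classP n m (h : form n) (g : form m) :
  witt_class h = witt_class g <-> witt_rel h g.
Proof.
rewrite /witt_class; split=> [/eqmodP/asboolP //|hg].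
exact/eqmodP/asboolP.
Qed.

Lemma witt_classW (P : W -> Prop) :
  (forall n (h : form n), P (witt_class h)) -> forall w, P w.
Proof. by move=> Ph w; rewrite -[w]reprK; case: (repr w) => n h; apply: Ph. Qed.

Definition witt_add (v w : W) : W :=
  witt_class (osum (projT2 (repr v)) (projT2 (repr w))).
Definition witt_opp (w : W) : W := witt_class (oppf (projT2 (repr w))).
Definition witt_zero : W := witt_class (zerof rho eps).

Lemma witt_repr n (h : form n) : witt_rel (projT2 (repr (witt_class h))) h.
Proof.
apply/witt_classP; rewrite [RHS](esym (reprK _)) /witt_class.
by case: (repr _).
Qed.

Lemma witt_addE n m (h : form n) (g : form m) :
  witt_add (witt_class h) (witt_class g) = witt_class (osum h g).
Proof. by apply/witt_classP/witt_rel_osum; apply: witt_repr. Qed.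

Lemma witt_oppE n (h : form n) : witt_opp (witt_class h) = witt_class (oppf h).
Proof. by apply/witt_classP/witt_rel_opp/witt_repr. Qed.

Fact witt_addA : associative witt_add.
Proof.
elim/witt_classW=> n h; elim/witt_classW=> m g; elim/witt_classW=> p k.
by rewrite !witt_addE; apply/witt_classP/witt_rel_iso/osumA.
Qed.
Fact witt_addC : commutative witt_add.
Proof.
elim/witt_classW=> n h; elim/witt_classW=> m g.
by rewrite !witt_addE; apply/witt_classP/witt_rel_iso/osumC.
Qed.
Fact witt_add0 : left_id witt_zero witt_add.
Proof.
elim/witt_classW=> n h.
by rewrite !witt_addE; apply/witt_classP/witt_rel_iso/osum0.
Qed.
Fact witt_addN : left_inverse witt_zero witt_opp witt_add.
Proof.
elim/witt_classW=> n h.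
rewrite witt_oppE !witt_addE; apply/witt_classP/witt_rel_metabolic.
exact: metabolic_opp.
Qed.

HB.instance Definition _ :=
  GRing.isZmodule.Build W witt_addA witt_addC witt_add0 witt_addN.

End WittGroup.

Definition sym_uniformizer (E : nzRingType) (V : numDomainType) (v : E -> V)
    (sigma : E -> E) (eps p : E) : Prop :=
  [/\ p != 0, sigma p = eps * p, 0 < v p
    & forall d, d != 0 -> 0 < v d -> v p <= v d].

Section Larmour.
Variables (E F : unitRingType) (V : numDomainType) (v : E -> V) (red : E -> F).

(* [sigma'] is the map induced by [sigma] modulo the maximal ideal. *)
Definition induced (sigma : E -> E) (sigma' : F -> F) : Prop :=
  forall d, val_ring v d -> val_ring v (sigma d) /\ red (sigma d) = sigma' (red d).

Variables (sigma : {additive E -> E}) (eps p : E).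

(* [h0] = <u_1, ..., u_n> is unramified and [h1] = <w_1, ..., w_m> ramified. *)
Definition larmour_pair n m (h0 : hform sigma eps n) (h1 : hform sigma eps m)
    (u : 'I_n -> E) (w : 'I_m -> E) : Prop :=
  [/\ diagonal h0 u, forall i, v (u i) = 0, diagonal h1 w
    & forall i, v (w i) = v p].

Definition larmour_decomposable : Prop :=
  forall r (h : hform sigma eps r),
  exists n m (h0 : hform sigma eps n) (h1 : hform sigma eps m) u w,
    larmour_pair h0 h1 u w /\ isometric h (osum h0 h1).

(* [del] sends the class of each h0 _|_ h1 to the pair of the residue forms
   <red u_i> and <red (w_i p^-1)>. *)
Definition larmour_residue (sigma0 sigma1 : {additive F -> F}) (eps0 eps1 : F)
    (del : witt sigma eps -> witt sigma0 eps0 * witt sigma1 eps1) : Prop :=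
  forall n m (h0 : hform sigma eps n) (h1 : hform sigma eps m) u w,
  larmour_pair h0 h1 u w ->
  exists (g0 : hform sigma0 eps0 n) (g1 : hform sigma1 eps1 m),
    [/\ diagonal g0 (fun i => red (u i)), diagonal g1 (fun i => red (w i / p))
      & del (witt_class (osum h0 h1)) = (witt_class g0, witt_class g1)].

End Larmour.

(* Main.v *)
Require Import Defs.
From HB Require Import structures.
From mathcomp Require Import all_boot all_order all_algebra ring.
From mathcomp Require Import boolp.
(* gives the lemmas on forms precedence over their namesakes in sesquilinear *)
Import Defs.

(** The residue isomorphism is built as the inverse of lifting.

    A form h over D lifts a form g over the residue algebra if, on vectors with
    entries in the valuation ring, h takes values in that ring and reduces to g.
    Over a general division ring with a discrete valuation, two facts about
    lifts carry the proof.

    - If h lifts g and g is isotropic, then g and h both lose a hyperbolic plane,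
      and what remains of h still lifts what remains of g
      ([lifts_reduce_isotropic]). Indeed splitting off an anisotropic vector is
      given by a formula that commutes with reduction, and a form of rank 1 is
      determined up to isometry by its reduction, by Hensel's lemma. So one can
      always pass to an anisotropic g. In particular, if g is trivial in the Witt
      group then so is h, because an anisotropic metabolic form has rank 0
      ([lifts_witt_zero]).

    - If h0 lifts g0 and h1 p^-1 lifts g1, where p is the uniformizer and g0 and
      g1 are anisotropic, then h0 + h1 is anisotropic, by Springer's comparison
      of valuations ([osum_anisotropic]).

    Relate the Witt class of h0 + h1 to the pair of classes of g0 and g1. This
    relation is additive; it is total on one side because forms can be
    diagonalized and their entries normalized to valuation 0 or v(p), and on
    the other because diagonal forms can be lifted; the two facts above say
    that its kernels are trivial. It is therefore the graph of an isomorphism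
    ([larmour_isomorphism]), whose values on diagonal forms hold by
    construction. That Witt-trivial forms are metabolic ([metabolic_cancel],
    [witt_zero_metabolic]) is what gives access to the kernels.

    For the quaternion algebra, the input is Hensel's lemma for square roots in
    K. It shows that the reduced norm form stays anisotropic modulo the maximal
    ideal ([residue_algebra_division]), so that nuD is the minimum of the
    valuations of the coordinates and the residue ring is the reduced quaternion
    algebra. It also gives, for t reducing to 1, a square root of t inside K(t)
    ([quat_sqrt]), which is the Hensel property for both tau_x and tau. *)

Set Implicit Arguments.
Unset Strict Implicit.
Unset Printing Implicit Defensive.

Import Order.TTheory GRing.Theory Num.Theory.
Local Open Scope ring_scope.

(** * Hermitian forms over a division ring with involution *)

Section RowVectors.
Variables (R : pzRingType) (n : nat).

Definition row_insert (i : 'I_n.+1) (w : 'rV[R]_n) : 'rV[R]_n.+1 :=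
  \row_j (if unlift i j is Some l then w 0 l else 0).

Lemma row_insert_lift i w l : row_insert i w 0 (lift i l) = w 0 l.
Proof. by rewrite mxE liftK. Qed.
Lemma row_insert_linear i : linear (row_insert i).
Proof.
move=> c u w; apply/rowP => j; rewrite !mxE.
by case: unliftP => [l _|_]; rewrite ?mxE // mulr0 addr0.
Qed.
Lemma row_insertK i : cancel (row_insert i) (col' i).
Proof. by move=> w; apply/rowP => l; rewrite mxE row_insert_lift. Qed.
Lemma row_dropK i (w : 'rV[R]_n.+1) : w 0 i = 0 -> row_insert i (col' i w) = w.
Proof.
move=> wi; apply/rowP => j; rewrite mxE.
by case: unliftP => [l ->|->]; rewrite ?mxE ?wi.
Qed.

End RowVectors.

(** The last condition says that c + eps rho(c) does not vanish identically,
   which excludes alternating forms and makes every form diagonalizable. *)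
Record hermitian_datum (E : unitRingType) (rho : {additive E -> E}) (eps : E)
    : Prop := {
  hd_div : forall d : E, d != 0 -> d \is a GRing.unit;
  hd_inv : is_involution rho;
  hd_eps : eps = 1 \/ eps = -1;
  hd_two : (2%:R : E) != 0;
  hd_alt : exists c, c + eps * rho c != 0 }.

Section Hermitian.
Variables (E : unitRingType) (rho : {additive E -> E}) (eps : E).
Hypothesis HE : hermitian_datum rho eps.
Local Notation form := (hform rho eps).

Lemma invol1 : rho 1 = 1. Proof. by case: (hd_inv HE). Qed.
Lemma involM c d : rho (c * d) = rho d * rho c.
Proof. by case: (hd_inv HE) => _ _ m _; apply: m. Qed.
Lemma involK : involutive rho. Proof. by case: (hd_inv HE). Qed.
Lemma invol_unit d : d \is a GRing.unit -> rho d \is a GRing.unit.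
Proof.
move=> ud; apply/unitrP; exists (rho d^-1).
by rewrite -!involM mulrV // mulVr // invol1.
Qed.
Lemma involV d : d \is a GRing.unit -> rho d^-1 = (rho d)^-1.
Proof.
by move=> ud; apply: (mulrI (invol_unit ud)); rewrite -involM mulVr // invol1 mulrV ?invol_unit.
Qed.
Lemma epsC d : eps * d = d * eps.
Proof. by case: (hd_eps HE) => ->; rewrite ?mul1r ?mulr1 ?mulN1r ?mulrN1. Qed.
Lemma epsK d : eps * (eps * d) = d.
Proof. by case: (hd_eps HE) => ->; rewrite ?mul1r ?mulN1r ?opprK. Qed.
Lemma invol_eps : rho eps = eps.
Proof. by case: (hd_eps HE) => ->; rewrite ?raddfN ?invol1. Qed.
Lemma invol_epsM d : rho (eps * d) = eps * rho d.
Proof. by rewrite involM invol_eps epsC. Qed.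
Lemma mulf0 (c d : E) : c * d = 0 -> c != 0 -> d = 0.
Proof. by move=> cd /(hd_div HE) uc; apply: (mulrI uc); rewrite cd mulr0. Qed.

Lemma formZl n (h : form n) c u v : h (c *: u) v = c * h u v.
Proof. by rewrite -[c *: u]addr0 form_linl form0l addr0. Qed.
Lemma formZr n (h : form n) c u v : h u (c *: v) = h u v * rho c.
Proof. by rewrite -[c *: v]addr0 form_linr form0r addr0. Qed.
Lemma formBl n (h : form n) u u' v : h (u - u') v = h u v - h u' v.
Proof. by rewrite formDl formNl. Qed.
Lemma formBr n (h : form n) u v v' : h u (v - v') = h u v - h u v'.
Proof. by rewrite formDr formNr. Qed.
Lemma form_sym n (h : form n) u : rho (h u u) = eps * h u u.
Proof. by rewrite {2}(form_herm h u u) epsK. Qed.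

Section Diag.
Variables (n : nat) (d : 'I_n -> E).
Hypothesis d_sym : forall i, rho (d i) = eps * d i.
Hypothesis d_neq0 : forall i, d i != 0.
Definition diag_fun (v w : 'rV[E]_n) := \sum_(i < n) v 0 i * d i * rho (w 0 i).
Fact diag_linl c u u' v :
  diag_fun (c *: u + u') v = c * diag_fun u v + diag_fun u' v.
Proof.
rewrite /diag_fun mulr_sumr -big_split; apply: eq_bigr => i _ /=.
by rewrite !mxE !mulrDl !mulrA.
Qed.
Fact diag_linr c u v v' :
  diag_fun u (c *: v + v') = diag_fun u v * rho c + diag_fun u v'.
Proof.
rewrite /diag_fun mulr_suml -big_split; apply: eq_bigr => i _ /=.
by rewrite !mxE raddfD involM mulrDr !mulrA.
Qed.
Fact diag_herm u v : diag_fun v u = eps * rho (diag_fun u v).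
Proof.
rewrite /diag_fun raddf_sum mulr_sumr; apply: eq_bigr => i _ /=.
by rewrite !involM involK d_sym !mulrA epsC -!mulrA epsK !mulrA.
Qed.
Lemma diag_unitE v i : diag_fun (delta_mx 0 i) v = d i * rho (v 0 i).
Proof.
rewrite /diag_fun (bigD1 i) //= big1 ?addr0 => [|j ji].
  by rewrite mxE !eqxx mul1r.
by rewrite mxE (negbTE ji) andbF !mul0r.
Qed.
Fact diag_nondeg v : (forall u, diag_fun u v = 0) -> v = 0.
Proof.
move=> dv; apply/rowP => i; rewrite mxE.
have := dv (delta_mx 0 i); rewrite diag_unitE => e.
by rewrite -[v 0 i]involK (mulf0 e (d_neq0 i)) raddf0.
Qed.
Definition diag_form : form n :=
  Form diag_linl diag_linr diag_herm diag_nondeg.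
End Diag.

Lemma diagonalP n (h : form n) d : diagonal h d ->
  forall i, rho (d i) = eps * d i /\ d i != 0.
Proof.
move=> hd i.
have hi v : h (delta_mx 0 i) v = d i * rho (v 0 i) by rewrite hd -(diag_unitE d).
have hii : h (delta_mx 0 i) (delta_mx 0 i) = d i.
  by rewrite hi mxE !eqxx invol1 mulr1.
split; first by rewrite -hii form_sym.
apply/eqP => di0; have : delta_mx 0 i = 0 :> 'rV[E]_n.
  by apply: (form_nondeg (h := h)) => u; apply: form_sym0; rewrite hi di0 mul0r.
by move/rowP/(_ i)/eqP; rewrite !mxE !eqxx oner_eq0.
Qed.

Lemma diagonal_ex n (d : 'I_n -> E) : (forall i, rho (d i) = eps * d i) ->
  (forall i, d i != 0) -> exists h : form n, diagonal h d.
Proof. by move=> s nz; exists (diag_form s nz). Qed.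

Lemma diagonal_iso n (h g : form n) d : diagonal h d -> diagonal g d ->
  isometric h g.
Proof.
move=> hd gd; apply: (@isometricI _ _ _ _ _ _ _ id id) => // u v.
by rewrite hd gd.
Qed.

Definition split_fun {T : Type} n m (d : 'I_n -> T) (e : 'I_m -> T)
  (i : 'I_(n + m)) : T := match split i with inl j => d j | inr j => e j end.

Lemma diagonal_osum n m (h : form n) (g : form m) d e :
  diagonal h d -> diagonal g e -> diagonal (osum h g) (split_fun d e).
Proof.
move=> hd ge v w; rewrite /= /osum_fun hd ge big_split_ord /split_fun /=.
by congr (_ + _); apply: eq_bigr => i _; rewrite !mxE ?lshiftK ?rshiftK;
   rewrite ?(unsplitK (inl i)) ?(unsplitK (inr i)).
Qed.

(** The isometry is right multiplication by c, which is linear for the left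
   structure. *)
Lemma diagonal_scale (g g' : form 1) d c : c != 0 ->
  diagonal g (fun=> d) -> diagonal g' (fun=> c * d * rho c) -> isometric g' g.
Proof.
move=> /(hd_div HE) uc gd gd'.
have fl : linear (fun u : 'rV[E]_1 => \row_j (u 0 j * c)).
  by move=> a x y; apply/rowP => j; rewrite !mxE mulrDl mulrA.
apply: (@isometricI _ _ _ _ _ _ _ _ (fun u : 'rV[E]_1 => \row_j (u 0 j / c)) fl).
- by move=> x; apply/rowP => j; rewrite !mxE mulrK.
- by move=> x; apply/rowP => j; rewrite !mxE mulrVK.
by move=> x y; rewrite gd gd' !big_ord1 !mxE involM !mulrA.
Qed.

(** Splitting off the line of an anisotropic vector X. The complement is
   parametrized explicitly, so that the construction can be compared with its
   reduction: choose i with X_i <> 0, identify E^n with the hyperplane of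
   vectors whose i-th entry is 0, and project that hyperplane onto the
   orthogonal of X along X. *)
Section Split.
Variables (n : nat) (h : form n.+1) (X : 'rV[E]_n.+1) (i : 'I_n.+1).
Hypothesis Xi : X 0 i != 0.
Hypothesis hX : h X X != 0.
Let d := h X X.
Let emb u := row_insert i u - (h (row_insert i u) X * d^-1) *: X.

Definition split_rest_fun (u v : 'rV[E]_n) :=
  h (row_insert i u) (row_insert i v) -
  h (row_insert i u) X * d^-1 * h X (row_insert i v).

Let ud : d \is a GRing.unit. Proof. exact: (hd_div HE). Qed.

Let emb_X u : h (emb u) X = 0.
Proof. by rewrite formBl formZl mulrVK // subrr. Qed.

Let emb_lin : linear emb.
Proof.
move=> c u v; rewrite /emb row_insert_linear form_linl mulrDl scalerDl opprD.
by rewrite addrACA scalerBr scalerA mulrA.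
Qed.

Let emb0 : emb 0 = 0.
Proof.
by have := emb_lin (-1) 0 0; rewrite scaleN1r oppr0 addr0 scaleN1r addNr.
Qed.

Let embE u v : h (emb u) (emb v) = split_rest_fun u v.
Proof.
rewrite {2}/emb formBr formZr emb_X mul0r subr0.
by rewrite formBl formZl.
Qed.

Fact split_linl c u u' v :
  split_rest_fun (c *: u + u') v = c * split_rest_fun u v + split_rest_fun u' v.
Proof. by rewrite -!embE emb_lin form_linl. Qed.
Fact split_linr c u v v' :
  split_rest_fun u (c *: v + v') = split_rest_fun u v * rho c + split_rest_fun u v'.
Proof. by rewrite -!embE emb_lin form_linr. Qed.
Fact split_herm u v : split_rest_fun v u = eps * rho (split_rest_fun u v).
Proof. by rewrite -!embE -form_herm. Qed.

Let glue (w : 'rV[E]_(1 + n)) : 'rV[E]_n.+1 :=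
  lsubmx w 0 0 *: X + emb (rsubmx w).
Let unglue (w : 'rV[E]_n.+1) : 'rV[E]_(1 + n) :=
  let r := col' i (w - (w 0 i / X 0 i) *: X) in
  row_mx (w 0 i / X 0 i + h (row_insert i r) X / d)%:M r.

Let ux : X 0 i \is a GRing.unit. Proof. exact: (hd_div HE). Qed.

Let unglueK : cancel unglue glue.
Proof.
move=> w; rewrite /glue /unglue row_mxKl row_mxKr mxE eqxx mulr1n /emb.
rewrite row_dropK; last by rewrite !mxE mulrVK // subrr.
by rewrite scalerDl addrACA subrr addr0 addrC subrK.
Qed.

Let glueK : cancel glue unglue.
Proof.
move=> w; rewrite /unglue.
have -> : glue w 0 i / X 0 i = lsubmx w 0 0 - h (row_insert i (rsubmx w)) X / d.
  by rewrite /glue /emb !mxE unlift_none sub0r -mulrBl mulrK.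
have -> : col' i (glue w - (lsubmx w 0 0 - h (row_insert i (rsubmx w)) X / d) *: X)
    = rsubmx w.
  rewrite -[RHS](row_insertK i); congr (col' _ _).
  by rewrite /glue /emb scalerBl opprB !addrA subrK addrAC subrr add0r.
rewrite subrK -[RHS]hsubmxK; congr row_mx.
by apply/matrixP => a b; rewrite !ord1 mxE eqxx mulr1n.
Qed.

Let glue_lin : linear glue.
Proof.
move=> c u v; rewrite /glue [rsubmx _]linearP /= emb_lin.
have -> : lsubmx (c *: u + v) 0 0 = c * lsubmx u 0 0 + lsubmx v 0 0.
  by rewrite !mxE.
by rewrite scalerDl [in RHS]scalerDr -scalerA addrACA.
Qed.

Let glueE u v : h (glue u) (glue v) =
  lsubmx u 0 0 * d * rho (lsubmx v 0 0) + split_rest_fun (rsubmx u) (rsubmx v).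
Proof.
rewrite /glue formDl !(formDr h _ (_ *: X)) !(formZl h _ X) !(formZr h _ _ X).
rewrite embE emb_X mul0r add0r (form_sym0 (emb_X _)) mulr0 addr0.
by rewrite [in LHS]mulrA.
Qed.

Fact split_nondeg v : (forall u, split_rest_fun u v = 0) -> v = 0.
Proof.
move=> hv; have : glue (row_mx 0 v) = 0.
  apply: (form_nondeg (h := h)) => w; rewrite -[w]unglueK glueE.
  by rewrite !(row_mxKl, row_mxKr) hv addr0 [(0 : 'rV_1) _ _]mxE raddf0 mulr0.
have -> : 0 = glue 0.
  by rewrite /glue !linear0 mxE scale0r emb0 addr0.
by move/(can_inj glueK); rewrite -(row_mx0 _ 1 1 n) => /eq_row_mx [].
Qed.

Definition split_rest : form n :=
  Form split_linl split_linr split_herm split_nondeg.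

Lemma split_iso (g : form 1) : diagonal g (fun=> h X X) ->
  isometric h (osum g split_rest).
Proof.
move=> gd; apply: isometric_sym; apply: (isometricI glue_lin glueK unglueK).
by move=> u v; rewrite glueE /= /osum_fun gd big_ord1.
Qed.
End Split.

Lemma div2_sum (t : E) : 2%:R^-1 * t + 2%:R^-1 * t = t.
Proof.
by rewrite -mulrDl -mulr2n -[_ *+ 2]mulr_natl divrr ?(hd_div HE) ?(hd_two HE) ?mul1r.
Qed.
(** The element 1/2 is central and fixed by the involution. *)
Lemma invol_div2 (t : E) : rho (2%:R^-1 * t) = 2%:R^-1 * rho t.
Proof.
rewrite involM involV ?(hd_div HE) ?(hd_two HE) // raddfMn invol1.
exact: commrV (commr_nat _ _).
Qed.

Lemma trace_div2 (t : E) : rho t = eps * t ->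
  2%:R^-1 * rho t * eps + rho (2%:R^-1 * rho t) = t.
Proof.
move=> st; rewrite invol_div2 involK st -mulrA -epsC epsK; exact: div2_sum.
Qed.

Lemma form_pair n (h : form n) x c : x != 0 -> exists u, h u x = c.
Proof.
move=> x0; have [u hu] : exists u, h u x != 0.
  apply: contrapT => no; case/eqP: x0; apply: (form_nondeg (h := h)) => u.
  by apply/eqP; apply: contrapT => hu; apply: no; exists u; apply/negP.
by exists ((c / h u x) *: u); rewrite formZl mulrVK ?(hd_div HE).
Qed.

(** If h(u, u) = 0 for all u then h(u, e) + eps rho(h(u, e)) = 0, although
   h(u, e) takes every value c when e <> 0. *)
Lemma non_alternating n (h : form n.+1) : exists X, h X X != 0.
Proof.
apply: contrapT => no; have alt u : h u u = 0.
  by apply/eqP; apply: contrapT => hu; apply: no; exists u; apply/negP.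
have e0 : delta_mx 0 ord0 != 0 :> 'rV[E]_n.+1.
  by apply/eqP => /rowP/(_ ord0)/eqP; rewrite !mxE !eqxx oner_eq0.
have [c] := hd_alt HE; have [u hu] := form_pair h c e0.
have := alt (u + delta_mx 0 ord0); rewrite formDl !formDr !alt add0r addr0.
by rewrite (form_herm h u) hu => ->; rewrite eqxx.
Qed.

Definition isotropic n (h : form n) := exists2 x, x != 0 & h x x = 0.
Definition represents n (h : form n) d := exists y, h y y = d.

(** With x isotropic and h(u, x) = 1, the value at c x + u is h(u, u) plus the
   arbitrary trace c eps + rho(c). *)
Lemma isotropic_universal n (h : form n) d :
  isotropic h -> rho d = eps * d -> represents h d.
Proof.
case=> x x0 hx sd; have [u hu] := form_pair h 1 x0.
have st : rho (d - h u u) = eps * (d - h u u).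
  by rewrite raddfB sd form_sym mulrBr.
have hxu : h x u = eps by rewrite (form_herm h u) hu invol1 mulr1.
exists ((2%:R^-1 * rho (d - h u u)) *: x + u).
rewrite formDl !formDr !formZl !formZr hx hu hxu mul0r mulr0 add0r mul1r addrA.
by rewrite trace_div2 // subrK.
Qed.

(** A zero (a, z) of <d> + h gives the value -d at a^-1 z if a <> 0; otherwise h
   itself is isotropic, hence universal. *)
Lemma isotropic_osum_represents n (g : form 1) (h : form n) d :
  diagonal g (fun=> d) -> isotropic (osum g h) -> represents h (- d).
Proof.
move=> gd [x x0]; rewrite /= /osum_fun gd big_ord1 => hx.
have [sd _] := diagonalP gd 0.
have [a0|a0] := eqVneq (lsubmx x 0 0) 0.
  apply: isotropic_universal; last by rewrite raddfN sd mulrN.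
  exists (rsubmx x); last by rewrite -hx a0 !mul0r add0r.
  apply: contra_neq x0 => r0; rewrite -[x]hsubmxK r0.
  rewrite -[RHS](row_mx0 _ 1 1 n); congr row_mx.
  by apply/matrixP => i j; rewrite !ord1 a0 mxE.
exists ((lsubmx x 0 0)^-1 *: rsubmx x); rewrite formZl formZr.
have ua := hd_div HE a0.
move/eqP: hx; rewrite addrC addr_eq0 => /eqP ->.
by rewrite involV // mulNr mulrN -!mulrA divrr ?invol_unit // mulr1 mulKr.
Qed.

Lemma anisotropic_entry n (h : form n.+1) X : h X X != 0 ->
  exists i, X 0 i != 0.
Proof.
move=> hX; apply/rV0Pn.
by apply: contra_neq hX => ->; rewrite form0l.
Qed.

Lemma diagonalize n (h : form n) :
  exists (k : form n) d, diagonal k d /\ isometric h k.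
Proof.
elim: n h => [|n IH] h.
  exists h, (fun=> 0); split; last exact: isometric_refl.
  by move=> v w; rewrite big_ord0 [v]thinmx0 form0l.
have [X hX] := non_alternating h; have [i Xi] := anisotropic_entry hX.
have [k [d [kd hk]]] := IH (split_rest Xi hX).
have [|//|g gd] := @diagonal_ex 1 (fun=> h X X); first by move=> _; rewrite form_sym.
exists (osum g k), (@split_fun E 1 n (fun=> h X X) d).
split; first exact: (@diagonal_osum 1 n g k).
apply: isometric_trans (split_iso Xi hX gd) _.
exact: osum_iso (isometric_refl _) hk.
Qed.

(** Induction on n: if X contains x with x_0 <> 0, subtracting multiples of x
   clears the first entry and reduces to n - 1; otherwise either the first
   coordinate already separates v from X, or it vanishes at v as well. *)
Lemma separating_functional n (X : 'rV[E]_n -> Prop) v :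
  X 0 -> (forall c u w, X u -> X w -> X (c *: u + w)) -> ~ X v ->
  exists phi : 'rV[E]_n -> E,
    [/\ forall c u w, phi (c *: u + w) = c * phi u + phi w,
        forall x, X x -> phi x = 0 & phi v != 0].
Proof.
elim: n X v => [|n IH] X v X0 Xl Xv.
  by case: Xv; rewrite [v]thinmx0.
pose X' z := X (row_insert ord0 z).
have ins0 : row_insert ord0 (0 : 'rV[E]_n) = 0.
  by apply/rowP => j; rewrite !mxE; case: unliftP => [l _|_] //; rewrite mxE.
have X'0 : X' 0 by rewrite /X' ins0.
have X'l c u w : X' u -> X' w -> X' (c *: u + w).
  by rewrite /X' row_insert_linear; apply: Xl.
have [[x Xx x0]|no] := pselect (exists2 x, X x & x 0 ord0 != 0).
  pose r (w : 'rV[E]_n.+1) := w - (w 0 ord0 / x 0 ord0) *: x.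
  have ux := hd_div HE x0.
  have rK w : row_insert ord0 (col' ord0 (r w)) = r w.
    by apply: row_dropK; rewrite !mxE mulrVK // subrr.
  have Xr w : X (r w) <-> X w.
    rewrite /r -scaleNr addrC; split=> [h|]; last exact: Xl.
    have e : w = (w 0 ord0 / x 0 ord0) *: x + (- (w 0 ord0 / x 0 ord0) *: x + w).
      by rewrite scaleNr addNKr.
    by rewrite e; apply: Xl.
  have rl c u w : col' ord0 (r (c *: u + w)) = c *: col' ord0 (r u) + col' ord0 (r w).
    apply/rowP => j; rewrite !mxE mulrDl mulrBr mulrDl opprD -!mulrA.
    by rewrite addrACA.
  have [phi [pl pX pv]] : exists phi : 'rV[E]_n -> E,
    [/\ forall c u w, phi (c *: u + w) = c * phi u + phi w,
        forall x, X' x -> phi x = 0 & phi (col' ord0 (r v)) != 0].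
    by apply: IH => //; rewrite /X' rK; move/Xr.
  exists (fun w => phi (col' ord0 (r w))); split=> //.
    by move=> c u w; rewrite rl pl.
  by move=> y Xy; apply: pX; rewrite /X' rK; apply/Xr.
have X_0 x : X x -> x 0 ord0 = 0.
  move=> Xx; apply/eqP; apply: contrapT => x0; apply: no; exists x => //.
  exact/negP.
have [v0|v0] := eqVneq (v 0 ord0) 0; last first.
  by exists (fun w => w 0 ord0); split=> // c u w; rewrite !mxE.
have [phi [pl pX pv]] : exists phi : 'rV[E]_n -> E,
    [/\ forall c u w, phi (c *: u + w) = c * phi u + phi w,
        forall x, X' x -> phi x = 0 & phi (col' ord0 v) != 0].
  by apply: IH => //; rewrite /X' row_dropK.
exists (fun w => phi (col' ord0 w)); split=> //.
  move=> c u w; rewrite -pl; congr phi.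
  by apply/rowP => j; rewrite !mxE.
by move=> x Xx; apply: pX; rewrite /X' row_dropK // X_0.
Qed.

(** For a diagonal form the vector is read off from the values of phi on the basis. *)
Lemma form_represents n (h : form n) (phi : 'rV[E]_n -> E) :
  (forall c u w, phi (c *: u + w) = c * phi u + phi w) ->
  exists y, forall w, h w y = phi w.
Proof.
move=> pl; have [k [d [kd [f [f' fK f'K] fh]]]] := diagonalize h.
have f'l : linear f'.
  by move=> c u v; apply: (can_inj fK); rewrite f'K linearP !f'K.
pose psi w := phi (f' w).
have psil c u w : psi (c *: u + w) = c * psi u + psi w by rewrite /psi f'l pl.
have psi0 : psi 0 = 0.
  by have := psil (-1) 0 0; rewrite scaleN1r oppr0 addr0 mulN1r addNr.
have psiE w : psi w = \sum_i w 0 i * psi (delta_mx 0 i).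
  rewrite {1}[w]row_sum_delta.
  elim/big_rec2: _ => [|i y1 y2 _ <-]; first exact: psi0.
  exact: psil.
exists (f' (\row_i rho ((d i)^-1 * psi (delta_mx 0 i)))) => w.
rewrite -fh f'K kd -[RHS]/(phi w) -[w in RHS]fK -/(psi _) psiE.
apply: eq_bigr => i _; rewrite mxE involK -mulrA mulVKr //.
by have [_ /(hd_div HE)] := diagonalP kd i.
Qed.

(** A subspace contains its double orthogonal: a functional that vanishes on X and
   not at v would be h(-, y) with y orthogonal to X. *)
Lemma double_orthogonal n (h : form n) (X : 'rV[E]_n -> Prop) v :
  X 0 -> (forall c u w, X u -> X w -> X (c *: u + w)) ->
  (forall y, (forall x, X x -> h x y = 0) -> h v y = 0) -> X v.
Proof.
move=> X0 Xl hv; apply: contrapT => Xv.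
have [phi [pl pX /eqP[]]] := separating_functional X0 Xl Xv.
by have [y hy] := form_represents h pl; rewrite -hy; apply: hv => x /pX; rewrite hy.
Qed.

Lemma metabolic_isometric n m (h : form n) (g : form m) :
  isometric h g -> metabolic h -> metabolic g.
Proof.
case=> f [f' fK f'K] fh [L [L0 Ll] Lh].
have f'l : linear f'.
  by move=> c u v; apply: (can_inj fK); rewrite f'K linearP !f'K.
exists (fun w => L (f' w)).
  split; last by move=> c u v Lu Lv; rewrite f'l; apply: Ll.
  by rewrite -(linear0 f) fK.
move=> v; rewrite Lh; split=> hL u.
  by move=> /hL; rewrite -fh !f'K.
by move=> Lu; rewrite -fh f'K; apply: hL; rewrite fK.
Qed.

(** Reduction of the Lagrangian L of h + M along the Lagrangian LM of M. That the
   vectors u with (u, w) in L for some w in LM form a Lagrangian of h comes from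
   taking the double orthogonal of L + LM. *)
Lemma metabolic_cancel n m (h : form n) (M : form m) :
  metabolic M -> metabolic (osum h M) -> metabolic h.
Proof.
case=> LM [M0 Ml] Mh [L [L0 Ll] Lh].
exists (fun u => exists2 w, LM w & L (row_mx u w)).
  split; first by exists 0; rewrite ?row_mx0.
  move=> c u v [w Mw Lw] [w' Mw' Lw']; exists (c *: w + w'); first exact: Ml.
  by rewrite -add_row_mx -scale_row_mx; apply: Ll.
move=> v; split=> [[w Mw Lw] u [w' Mw' Lw']|hv].
  have /Lh/(_ _ Lw') := Lw; rewrite /= /osum_fun !(row_mxKl, row_mxKr).
  by have /Mh/(_ _ Mw') -> := Mw; rewrite addr0.
(* The sum of L and LM inside the orthogonal sum. *)
pose X y := exists l w, [/\ L l, LM w & y = l + row_mx 0 w].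
have [l [w [Ll' Mw e]]] : X (row_mx v 0).
  apply: (double_orthogonal (h := osum h M)).
  - by exists 0, 0; split; rewrite ?row_mx0 ?addr0.
  - move=> c _ _ [l [w [Ll1 Mw ->]]] [l' [w' [Ll1' Mw' ->]]].
    exists (c *: l + l'), (c *: w + w'); split; [exact: Ll|exact: Ml|].
    by rewrite scalerDr addrACA scale_row_mx add_row_mx scaler0 addr0.
  - move=> y hy; rewrite /= /osum_fun row_mxKl row_mxKr form0l addr0.
    apply/form_sym0/hv; exists (rsubmx y).
      apply/Mh => w Mw; have := hy (row_mx 0 w).
      rewrite /= /osum_fun row_mxKl row_mxKr form0l add0r; apply.
      by exists 0, w; rewrite add0r.
    rewrite hsubmxK; apply/Lh => l Ll1; apply: hy; exists l, 0.
    by rewrite row_mx0 addr0.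
exists (- w).
  by rewrite -[- w]addr0 -scaleN1r; apply: Ml.
suff <- : l = row_mx v (- w) by [].
apply: (addIr (row_mx 0 w)).
by rewrite -e add_row_mx addr0 addNr.
Qed.

(** Hence metabolic forms are exactly the representatives of 0 in the Witt
   group, which makes triviality a property of the form itself. *)
Lemma witt_zero_metabolic n (h : form n) : witt_rel h (zerof rho eps) ->
  metabolic h.
Proof.
case=> p [q [M [N [mM mN i]]]]; apply: (metabolic_cancel mM).
apply: metabolic_isometric (isometric_sym i) _.
exact: metabolic_osum (metabolic0 _ _) mN.
Qed.

(** A Lagrangian consists of isotropic vectors, so it is 0, and its orthogonal is everything. *)
Lemma anisotropic_metabolic n (h : form n) :
  ~ isotropic h -> metabolic h -> n = 0%N.
Proof.
move=> an [L [L0 _] Lh].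
have L_0 v : L v -> v = 0.
  move=> Lv; apply/eqP; apply: contrapT => v0; apply: an; exists v.
    exact/negP.
  by have /Lh := Lv; apply.
case: n h an L L0 Lh L_0 => // n h an L L0 Lh L_0.
have /L_0/rowP/(_ ord0)/eqP : L (delta_mx 0 ord0).
  by apply/Lh => u /L_0 ->; rewrite form0l.
by rewrite !mxE !eqxx oner_eq0.
Qed.

Lemma witt_rank0 n (h : form n) : n = 0%N -> witt_rel h (zerof rho eps).
Proof.
move=> n0; apply: witt_rel_metabolic; exists (fun=> True) => // v.
by split=> // _ u _; move: h u v; rewrite n0 => h u v; rewrite [u]thinmx0 form0l.
Qed.

End Hermitian.

(** * Lifts of forms along a reduction map *)

Section WittExtra.
Variables (E : unitRingType) (rho : {additive E -> E}) (eps : E).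
Local Notation form := (hform rho eps).

Lemma isotropic_isometric n m (h : form n) (g : form m) :
  isometric h g -> isotropic h -> isotropic g.
Proof.
case=> f [f' fK _] fh [x x0 hx]; exists (f x); last by rewrite fh.
by apply: contra_neq x0 => fx; rewrite -[x]fK fx -(linear0 f) fK.
Qed.

(** The sum of a and b is isometric to the metabolic form a + (- a). *)
Lemma hyperbolic_cancel n m (a b : form n) (k : form m) :
  isometric b (oppf a) -> witt_rel (osum a (osum b k)) k.
Proof.
move=> ba; apply: (witt_rel_trans (witt_rel_iso (osumA _ _ _))).
apply: (@witt_rel_trans _ _ _ _ _ _ _ (osum (zerof rho eps) k)).
  apply: witt_rel_osum; last exact: witt_rel_refl.
  apply: (witt_rel_trans (witt_rel_iso (osumC _ _))).
  apply: (witt_rel_trans (witt_rel_osum (witt_rel_iso ba) (witt_rel_refl _))).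
  exact/witt_rel_metabolic/metabolic_opp.
exact/witt_rel_iso/osum0.
Qed.

Lemma diagonal_oppf n (h : form n) d : diagonal h d ->
  diagonal (oppf h) (fun i => - d i).
Proof.
move=> hd u w; rewrite /= /oppf_fun hd -sumrN.
by apply: eq_bigr => i _; rewrite mulrN mulNr.
Qed.

End WittExtra.

(** Valuation rings of division rings, with residue map red. *)
Section Residue.
Variables (E F : unitRingType) (V : realDomainType) (v : E -> V) (red : E -> F).
Hypothesis res : residue_map v red.
Hypothesis divE : forall d : E, d != 0 -> d \is a GRing.unit.
Hypothesis vM : forall c d, c != 0 -> d != 0 -> v (c * d) = v c + v d.
Local Notation O := (val_ring v).

Lemma val_ring0 : O 0. Proof. by left. Qed.
Lemma val_ringB c d : O c -> O d -> O (c - d) /\ red (c - d) = red c - red d.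
Proof. by move=> Oc Od; have [? _ ? _] := residue_ring res Oc Od. Qed.
Lemma val_ringM c d : O c -> O d -> O (c * d) /\ red (c * d) = red c * red d.
Proof. by move=> Oc Od; have [_ ? _ ?] := residue_ring res Oc Od. Qed.
Lemma red0 : red 0 = 0.
Proof. by have [_] := val_ringB val_ring0 val_ring0; rewrite !subrr. Qed.
Lemma val_ringN d : O d -> O (- d) /\ red (- d) = - red d.
Proof. by move=> Od; have := val_ringB val_ring0 Od; rewrite red0 !sub0r. Qed.
Lemma val_ringD c d : O c -> O d -> O (c + d) /\ red (c + d) = red c + red d.
Proof.
move=> Oc Od; have [ON rN] := val_ringN Od.
by have := val_ringB Oc ON; rewrite rN !opprK.
Qed.
Lemma val_ring_sum n (f : 'I_n -> E) : (forall i, O (f i)) ->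
  O (\sum_i f i) /\ red (\sum_i f i) = \sum_i red (f i).
Proof.
move=> Of; elim/big_rec2: _ => [|i y1 y2 _ [Oy <-]].
  by split; [exact: val_ring0|exact: red0].
exact: val_ringD.
Qed.

Lemma v1 : v 1 = 0.
Proof. by apply: (addrI (v 1)); rewrite addr0 -vM ?oner_neq0 ?mulr1. Qed.
Lemma val_ring1 : O 1. Proof. by right; rewrite v1. Qed.
Lemma div_invr_neq0 (d : E) : d != 0 -> d^-1 != 0.
Proof. by move=> /divE; rewrite -unitrV; apply: contraTneq => ->; rewrite unitr0. Qed.
Lemma div_mulf_neq0 (c d : E) : c != 0 -> d != 0 -> c * d != 0.
Proof.
by move=> /divE uc; apply: contra_neq => cd; apply: (mulrI uc); rewrite cd mulr0.
Qed.
Lemma vV d : d != 0 -> v d^-1 = - v d.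
Proof.
move=> d0; apply: (addrI (v d)).
by rewrite subrr -vM ?div_invr_neq0 // divrr ?divE // v1.
Qed.
Lemma vN d : d != 0 -> v (- d) = v d.
Proof.
move=> d0; have n0 : (-1 : E) != 0 by rewrite oppr_eq0 oner_neq0.
have vN1 : v (-1) = 0.
  have := vM n0 n0; rewrite mulrNN mulr1 v1 => /esym/eqP.
  by rewrite -mulr2n mulrn_eq0 => /eqP.
by rewrite -mulN1r vM // vN1 add0r.
Qed.

Lemma red_eq0 d : O d -> d != 0 -> (red d == 0) = (0 < v d).
Proof.
move=> Od d0; apply/eqP/idP => [/(residue_ker res Od)[/eqP|//]|vd].
  by rewrite (negbTE d0).
by apply/(residue_ker res Od); right.
Qed.
Lemma val_unit d : d != 0 -> v d = 0 -> O d /\ red d != 0.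
Proof.
by move=> d0 vd; have Od : O d by [right; rewrite vd]; rewrite red_eq0 // vd ltxx.
Qed.
Lemma red_unit d : O d -> red d != 0 ->
  [/\ d != 0, v d = 0, O d^-1 & red d^-1 = (red d)^-1].
Proof.
move=> Od rd; have d0 : d != 0 by apply: contra_neq rd => ->; exact: red0.
have vd : v d = 0.
  have [/eqP|] := Od; first by rewrite (negbTE d0).
  by rewrite le_eqVlt -red_eq0 // (negbTE rd) orbF => /eqP.
have OV : O d^-1 by right; rewrite vV // vd oppr0.
have [_ rV] := val_ringM Od OV; have [_ rV'] := val_ringM OV Od.
split=> //; rewrite mulrV ?divE // (residue_1 res) in rV.
rewrite mulVr ?divE // (residue_1 res) in rV'.
have ur : red d \is a GRing.unit by apply/unitrP; exists (red d^-1).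
by apply: (mulrI ur); rewrite mulrV.
Qed.

Definition integral n (u : 'rV[E]_n) := forall j, O (u 0 j).
Definition redv n (u : 'rV[E]_n) : 'rV[F]_n := map_mx red u.

Lemma redv_surj n (x : 'rV[F]_n) : exists2 X, integral X & redv X = x.
Proof.
have /choice[f Hf] : forall j : 'I_n, exists d, O d /\ red d = x 0 j.
  by move=> j; have [d Od rd] := residue_surj res (x 0 j); exists d.
exists (\row_j f j); first by move=> j; rewrite mxE; case: (Hf j).
by apply/rowP => j; rewrite !mxE; case: (Hf j).
Qed.

(** Multiply by the inverse of an entry of least valuation: that entry becomes 1. *)
Lemma primitive_multiple n (u : 'rV[E]_n) : u != 0 ->
  exists c, [/\ c != 0, integral (c *: u) & redv (c *: u) != 0].
Proof.
move=> /rV0Pn[i0 ui0].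
have [i ui min] := @arg_minP _ _ _ i0 (fun i => u 0 i != 0) (fun i => v (u 0 i)) ui0.
exists (u 0 i)^-1; split; first exact: div_invr_neq0.
  move=> j; rewrite mxE; have [->|uj] := eqVneq (u 0 j) 0; first by left; rewrite mulr0.
  by right; rewrite vM ?div_invr_neq0 // vV // addrC subr_ge0 min.
apply/eqP => /rowP/(_ i)/eqP; rewrite !mxE mulVr ?divE //.
by rewrite (residue_1 res) oner_eq0.
Qed.

End Residue.

(** What lifting forms requires: the involutions correspond under reduction, eps is
   the same sign on both sides, and a form of rank 1 is determined by its
   reduction. The last point is Hensel's lemma: t has a square root c that
   satisfies the symmetry relation of t, so <t u> = <c u rho(c)> is isometric to <u>. *)
Record lifting_datum (E F : unitRingType) (V : realDomainType) (v : E -> V)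
    (red : E -> F) (rho : {additive E -> E}) (eps : E) (rho' : {additive F -> F})
    (eps' : F) : Prop := {
  ld_source : hermitian_datum rho eps;
  ld_target : hermitian_datum rho' eps';
  ld_residue : residue_map v red;
  ld_val : forall c d, c != 0 -> d != 0 -> v (c * d) = v c + v d;
  ld_induced : induced v red rho rho';
  ld_eps : (eps = 1 /\ eps' = 1) \/ (eps = -1 /\ eps' = -1);
  ld_hensel : forall t, val_ring v t -> red t = 1 ->
    exists2 c, c * c = t & forall u, t * u = u * rho t -> c * u = u * rho c }.

Section Lifting.
Variables (E F : unitRingType) (V : realDomainType) (v : E -> V) (red : E -> F).
Variables (rho : {additive E -> E}) (eps : E).
Variables (rho' : {additive F -> F}) (eps' : F).
Hypothesis LD : lifting_datum v red rho eps rho' eps'.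
Local Notation O := (val_ring v).
Local Notation integral := (integral v).
Local Notation redv := (redv red).
Let HE : hermitian_datum rho eps. Proof. exact: (ld_source LD). Qed.
Let HF : hermitian_datum rho' eps'. Proof. exact: (ld_target LD). Qed.
Let res : residue_map v red. Proof. exact: (ld_residue LD). Qed.
Let divE : forall d : E, d != 0 -> d \is a GRing.unit.
Proof. exact: (hd_div HE). Qed.
Let vM : forall c d, c != 0 -> d != 0 -> v (c * d) = v c + v d.
Proof. exact: (ld_val LD). Qed.

Lemma red_invol d : O d -> O (rho d) /\ red (rho d) = rho' (red d).
Proof. exact: (ld_induced LD). Qed.

Lemma red_eps d : O d -> O (eps * d) /\ red (eps * d) = eps' * red d.
Proof.
move=> Od; case: (ld_eps LD) => -[-> ->]; rewrite ?mul1r ?mulN1r //.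
exact: (val_ringN res Od).
Qed.

(** On integral vectors h is integral and reduces to g. Since g is nondegenerate,
   this says that the standard lattice is unimodular for h, with reduction g. *)
Definition lifts n (h : hform rho eps n) (g : hform rho' eps' n) : Prop :=
  forall u w, integral u -> integral w ->
    O (h u w) /\ red (h u w) = g (redv u) (redv w).

Lemma lifts_osum n m (h : hform rho eps n) g (k : hform rho eps m) l :
  lifts h g -> lifts k l -> lifts (osum h k) (osum g l).
Proof.
move=> hg kl u w iu iw; rewrite /= /osum_fun.
have il (z : 'rV_(n + m)) : integral z -> integral (lsubmx z : 'rV_n).
  by move=> iz j; rewrite mxE.
have ir (z : 'rV_(n + m)) : integral z -> integral (rsubmx z : 'rV_m).
  by move=> iz j; rewrite mxE.
have [Oh rh] := hg _ _ (il u iu) (il w iw).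
have [Ok rk] := kl _ _ (ir u iu) (ir w iw).
have [OD rD] := val_ringD res Oh Ok; split=> //.
by rewrite rD rh rk /redv map_lsubmx map_rsubmx map_lsubmx map_rsubmx.
Qed.

Lemma lifts_diagonal n (h : hform rho eps n) g d :
  diagonal h d -> (forall i, O (d i)) -> diagonal g (fun i => red (d i)) ->
  lifts h g.
Proof.
move=> hd Od gd u w iu iw; rewrite hd gd.
have T i : O (u 0 i * d i * rho (w 0 i)) /\
    red (u 0 i * d i * rho (w 0 i)) = red (u 0 i) * red (d i) * rho' (red (w 0 i)).
  have [O1 r1] := val_ringM res (iu i) (Od i).
  have [O2 r2] := red_invol (iw i).
  by have [O3 r3] := val_ringM res O1 O2; rewrite r3 r1 r2.
have [|Os ->] := @val_ring_sum _ _ _ _ _ res _ (fun i => u 0 i * d i * rho (w 0 i)).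
  by move=> i; case: (T i).
split=> //; apply: eq_bigr => i _; rewrite !mxE; by case: (T i).
Qed.

(** The complement of X is given by a formula in which only the unit h(X, X) is
   inverted, so that it commutes with reduction. *)
Lemma lifts_split n (h : hform rho eps n.+1) (g : hform rho' eps' n.+1)
    (X : 'rV[E]_n.+1) (i : 'I_n.+1)
    (Xi : X 0 i != 0) (hX : h X X != 0)
    (xi : redv X 0 i != 0) (gx : g (redv X) (redv X) != 0) :
  lifts h g -> integral X -> lifts (split_rest HE Xi hX) (split_rest HF xi gx).
Proof.
move=> hg iX u w iu iw; rewrite /= /split_rest_fun.
have ins (z : 'rV[E]_n) : integral z -> integral (row_insert i z) /\
    redv (row_insert i z) = row_insert i (redv z).
  move=> iz; split.
    by move=> j; rewrite mxE; case: unliftP => [l _|_] //; apply: val_ring0.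
  apply/rowP => j; rewrite !mxE; case: unliftP => [l _|_]; first by rewrite mxE.
  exact: (red0 res).
have [iu' ru] := ins u iu; have [iw' rw] := ins w iw.
have [O1 r1] := hg _ _ iu' iw'; have [O2 r2] := hg _ _ iu' iX.
have [O3 r3] := hg _ _ iX iw'; have [O4 r4] := hg _ _ iX iX.
have [|_ _ O5 r5] := red_unit res divE vM O4; first by rewrite r4.
have [O6 r6] := val_ringM res O2 O5; have [O7 r7] := val_ringM res O6 O3.
have [O8 r8] := val_ringB res O1 O7; split=> //.
by rewrite r8 r7 r6 r5 r1 r2 r3 r4 ru rw.
Qed.

(** The quotient of d' by d reduces to 1, so the square root of that quotient is an isometry. *)
Lemma hensel_isometric d d' (g g' : hform rho eps 1) :
  diagonal g (fun=> d) -> diagonal g' (fun=> d') -> O d -> O d' ->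
  red d = red d' -> red d != 0 -> isometric g' g.
Proof.
move=> gd gd' Od Od' rdd rd.
have [d0 _ OV rV] := red_unit res divE vM Od rd.
have [sd _] := diagonalP HE gd 0; have [sd' d0'] := diagonalP HE gd' 0.
have ud := divE d0.
have [Ot rt] := val_ringM res Od' OV.
have [|c cc cu] := ld_hensel LD Ot.
  by rewrite rt rV -rdd mulrV // (hd_div HF).
have tcom : d' / d * d = d * rho (d' / d).
  have : eps * (d' / d * d) = eps * (d * rho (d' / d)).
    by rewrite [RHS]mulrA -sd -(involM HE) mulrVK.
  by move/(congr1 ( *%R eps)); rewrite !(epsK HE).
have c0 : c != 0.
  apply: contra_neq d0' => c0; rewrite -[d'](mulrVK ud) -cc c0.
  by rewrite mul0r mul0r.
apply: (diagonal_scale HE c0 gd) => x y.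
by rewrite -mulrA -(cu _ tcom) mulrA cc mulrVK.
Qed.

Lemma lifts_split_off n (h : hform rho eps n) (g : hform rho' eps' n) y :
  lifts h g -> g y y != 0 ->
  exists m (h' : hform rho eps m) (g' : hform rho' eps' m) d
    (a : hform rho eps 1) (b : hform rho' eps' 1),
  [/\ O d /\ red d = g y y, n = m.+1, lifts h' g',
      diagonal a (fun=> d) /\ isometric h (osum a h')
    & diagonal b (fun=> g y y) /\ isometric g (osum b g')].
Proof.
have [Y iY <-] := redv_surj res y => hg gy.
case: n h g {y} Y iY hg gy => [|n] h g Y iY hg gy.
  by rewrite [redv _]thinmx0 form0l eqxx in gy.
have [Ok rk] := hg _ _ iY iY.
have hY : h Y Y != 0 by apply: contra_neq gy => hY; rewrite -rk hY (red0 res).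
have [i yi] := anisotropic_entry gy.
have Yi : Y 0 i != 0.
  by apply: contra_neq yi => Yi; rewrite !mxE Yi (red0 res).
have [|//|a ad] := @diagonal_ex _ _ _ HE 1 (fun=> h Y Y).
  by move=> _; rewrite (form_sym HE).
have [|//|b bd] := @diagonal_ex _ _ _ HF 1 (fun=> g (redv Y) (redv Y)).
  by move=> _; rewrite (form_sym HF).
exists n, (split_rest HE Yi hY), (split_rest HF yi gy), (h Y Y), a, b.
split=> //; first exact: lifts_split.
  by split=> //; apply: split_iso.
by split=> //; apply: split_iso.
Qed.

(** If g is isotropic and d = g(y, y) <> 0, the complement of y represents -d.
   Splitting off both vectors on the two levels removes <d, -d> from g and, after
   comparing forms of rank 1 with the same reduction, a hyperbolic plane from h. *)
Lemma lifts_reduce_isotropic n (h : hform rho eps n) g :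
  lifts h g -> isotropic g ->
  exists m (h' : hform rho eps m) g',
    [/\ (m < n)%N, lifts h' g', witt_rel h h' & witt_rel g g'].
Proof.
move=> hg iso; have [y gy] : exists y, g y y != 0.
  case: n h g hg iso => [|n] h g hg iso; last exact: (non_alternating HF).
  by case: iso => x; rewrite [x]thinmx0 eqxx.
have [n1 [h1 [g1 [d [a [b [[Od rd] n_eq hg1 [ad ha] [bd gb]]]]]]]] := lifts_split_off hg gy.
have [z gz] := isotropic_osum_represents HF bd (isotropic_isometric gb iso).
have gz0 : g1 z z != 0 by rewrite gz oppr_eq0.
have [n2 [h2 [g2 [e [a' [b' [[Oe re] n1_eq hg2 [ad' ha'] [bd' gb']]]]]]]] :=
  lifts_split_off hg1 gz0.
exists n2, h2, g2; split=> //; first by rewrite n_eq n1_eq.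
  apply: (@witt_rel_trans _ _ _ _ _ _ _ (osum a (osum a' h2))).
    exact/witt_rel_iso/(isometric_trans ha)/(osum_iso (isometric_refl _)).
  apply: hyperbolic_cancel.
  have [ON rN] := val_ringN res Od.
  apply: (hensel_isometric (diagonal_oppf ad) ad' ON Oe).
    by rewrite rN rd re gz.
  by rewrite rN rd oppr_eq0.
apply: (@witt_rel_trans _ _ _ _ _ _ _ (osum b (osum b' g2))).
  exact/witt_rel_iso/(isometric_trans gb)/(osum_iso (isometric_refl _)).
apply: hyperbolic_cancel; rewrite gz in bd'.
exact: (diagonal_iso bd' (diagonal_oppf bd)).
Qed.

(** The Witt decomposition of g, carried out simultaneously on g and on its lift. *)
Lemma lifts_anisotropic n (h : hform rho eps n) g : lifts h g ->
  exists m (h' : hform rho eps m) g',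
    [/\ lifts h' g', ~ isotropic g', witt_rel h h' & witt_rel g g'].
Proof.
elim: n {-2}n (leqnn n) h g => [|N IH] n nN h g hg.
  exists n, h, g; split=> //; try exact: witt_rel_refl.
  move: nN h g hg; rewrite leqn0 => /eqP -> h g _ [x].
  by rewrite [x]thinmx0 eqxx.
have [iso|] := pselect (isotropic g); last first.
  by exists n, h, g; split=> //; apply: witt_rel_refl.
have [m [h' [g' [mn hg' hh gg]]]] := lifts_reduce_isotropic hg iso.
have [|p [h2 [g2 [hg2 an hh2 gg2]]]] := IH m _ h' g' hg'.
  by rewrite -ltnS (leq_trans mn).
exists p, h2, g2; split=> //.
  exact: witt_rel_trans hh hh2.
exact: witt_rel_trans gg gg2.
Qed.

(** After passing to anisotropic g, triviality of its Witt class forces rank 0.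
   Applied to orthogonal sums with an opposite form, this says that the Witt
   class of a lift depends only on the Witt class of the reduction. *)
Lemma lifts_witt_zero n (h : hform rho eps n) g : lifts h g ->
  witt_rel g (zerof rho' eps') -> witt_rel h (zerof rho eps).
Proof.
move=> hg g0; have [m [h' [g' [_ an hh gg]]]] := lifts_anisotropic hg.
apply: (witt_rel_trans hh); apply: witt_rank0.
apply: (anisotropic_metabolic an); apply: (witt_zero_metabolic HF).
exact: witt_rel_trans (witt_rel_sym gg) g0.
Qed.

Lemma lifts_diagonal_ex n (d : 'I_n -> E) :
  (forall i, rho (d i) = eps * d i) -> (forall i, O (d i)) ->
  (forall i, red (d i) != 0) ->
  exists h g, [/\ diagonal h d, diagonal g (fun i => red (d i)) & lifts h g].
Proof.
move=> sd Od rd.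
have [|h hd] := diagonal_ex HE sd.
  by move=> i; have [] := red_unit res divE vM (Od i) (rd i).
have [||g gd] := @diagonal_ex _ _ _ HF _ (fun i => red (d i)) => //.
  move=> i; have [_ <-] := red_invol (Od i); rewrite sd.
  by have [_] := red_eps (Od i).
exists h, g; split=> //; exact: lifts_diagonal.
Qed.

(** Diagonalize g and lift its entries; averaging d and eps rho(d) makes a lift d of
   an entry symmetric without changing its reduction. *)
Lemma lifts_exists n (g : hform rho' eps' n) :
  exists (h : hform rho eps n) g', lifts h g' /\ isometric g g'.
Proof.
have [k [e [ke gk]]] := diagonalize HF g.
have sym i : exists d, [/\ O d, red d = e i & rho d = eps * d].
  have [d Od rd] := residue_surj res (e i); have [se _] := diagonalP HF ke i.
  have [O2 r2] : O 2%:R /\ red 2%:R = 2%:R.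
    have O1 := val_ring1 vM; rewrite mulr2n.
    by have [? ->] := val_ringD res O1 O1; rewrite (residue_1 res).
  have [|_ _ OV rV] := red_unit res divE vM O2; first by rewrite r2 (hd_two HF).
  have [Or rr] := red_invol Od; have [Oe re] := red_eps Or.
  have [OD rD] := val_ringD res Od Oe; have [OM rM] := val_ringM res OV OD.
  exists (2%:R^-1 * (d + eps * rho d)); split=> //.
    rewrite rM rV rD re rr rd r2 se (epsK HF).
    by rewrite mulrDr (div2_sum HF).
  rewrite (invol_div2 HE) raddfD (invol_epsM HE) (involK HE).
  have C x : eps * (2%:R^-1 * x) = 2%:R^-1 * (eps * x).
    by rewrite mulrA (epsC HE) mulrA.
  by rewrite C [eps * (_ + _)]mulrDr (epsK HE) addrC.
have /choice[d Hd] := sym.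
have [|||h [g' [hd g'd hg']]] := @lifts_diagonal_ex _ d.
- by move=> i; case: (Hd i).
- by move=> i; case: (Hd i).
- by move=> i; case: (Hd i) => _ -> _; have [] := diagonalP HF ke i.
exists h, g'; split=> //; apply: (isometric_trans gk).
apply: (@diagonal_iso _ _ _ _ _ _ e) => // x w; rewrite g'd.
by apply: eq_bigr => i _; case: (Hd i) => _ -> _.
Qed.
End Lifting.

(** * The residue isomorphism *)

(** An additive relation that is total and has trivial kernel on both sides is the
   graph of an isomorphism. *)
Lemma additive_bijection (U W : zmodType) (R : U -> W -> Prop) :
  (forall u u' w w', R u w -> R u' w' -> R (u + u') (w + w')) ->
  (forall u, exists w, R u w) -> (forall w, exists u, R u w) ->
  (forall u, R u 0 -> u = 0) -> (forall w, R 0 w -> w = 0) ->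
  exists f : {additive U -> W}, bijective f /\ forall u w, R u w -> f u = w.
Proof.
move=> RD Rl Rr R_0 R0_.
have Rfun u w w' : R u w -> R u w' -> w = w'.
  move=> uw uw'; have [z uz] := Rl (- u).
  have /R0_ e : R 0 (w + z) by rewrite -(subrr u); apply: RD.
  have /R0_ e' : R 0 (w' + z) by rewrite -(subrr u); apply: RD.
  by apply: (addIr z); rewrite e e'.
have Rinj w u u' : R u w -> R u' w -> u = u'.
  move=> uw u'w; have [z zw] := Rr (- w).
  have /R_0 e : R (u + z) 0 by rewrite -(subrr w); apply: RD.
  have /R_0 e' : R (u' + z) 0 by rewrite -(subrr w); apply: RD.
  by apply: (addIr z); rewrite e e'.
have /choice[f Rf] := Rl; have /choice[g Rg] := Rr.
have fD : zmod_morphism f.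
  move=> x y; have [z Rz] := Rl (- y).
  apply: (Rfun (x - y)) => //.
  have -> : - f y = z.
    apply: (addrI (f y)); rewrite subrr; apply: esym; apply: R0_.
    by rewrite -(subrr y); apply: RD.
  exact: RD.
pose fA : {additive U -> W} := HB.pack f (GRing.isZmodMorphism.Build U W f fD).
exists fA; split; last first.
  by move=> u w; apply: Rfun.
exists g => u /=; first by apply: (Rinj (f u)).
by apply: (Rfun (g u)).
Qed.

(** A form h for sigma and its multiple h p^-1, which is a 1-hermitian form for
   sigma1, carry the same information. The ramified part of a form is studied
   through this multiple, which is unramified. *)
Section Larmour.
Variables (E F : unitRingType) (V : realDomainType) (v : E -> V) (red : E -> F).
Variables (sigma : {additive E -> E}) (eps p : E) (sigma1 : {additive E -> E}).
Variables (rho0 : {additive F -> F}) (eps0 : F) (rho1 : {additive F -> F}).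
Hypothesis L0 : lifting_datum v red sigma eps rho0 eps0.
Hypothesis L1 : lifting_datum v red sigma1 1 rho1 1.
Hypothesis pU : sym_uniformizer v sigma eps p.
Hypothesis sigma1E : conj_inv sigma p =1 sigma1.
Let HE : hermitian_datum sigma eps. Proof. exact: (ld_source L0). Qed.
Let res : residue_map v red. Proof. exact: (ld_residue L0). Qed.
Let divE : forall d : E, d != 0 -> d \is a GRing.unit.
Proof. exact: (hd_div HE). Qed.
Let vM : forall c d : E, c != 0 -> d != 0 -> v (c * d) = v c + v d.
Proof. exact: (ld_val L0). Qed.
Let p0 : p != 0. Proof. by case: pU. Qed.
Let up : p \is a GRing.unit. Proof. exact: divE. Qed.
Let sigmap : sigma p = eps * p. Proof. by case: pU. Qed.

Definition scaled n (h : hform sigma eps n) (h' : hform sigma1 1 n) : Prop :=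
  forall u w, h' u w = h u w * p^-1.

Lemma sigma_p d : p * sigma d = sigma1 d * p.
Proof. by rewrite -sigma1E /conj_inv mulrVK. Qed.

Lemma sigma_pV d : sigma d * p^-1 = p^-1 * sigma1 d.
Proof. by rewrite -sigma1E /conj_inv !mulrA mulVr // mul1r. Qed.

Lemma sigmapV : sigma p^-1 = eps * p^-1.
Proof.
rewrite (involV HE) // sigmap; apply: (mulrI (_ : eps * p \is a GRing.unit)).
  by rewrite -sigmap (invol_unit HE).
rewrite mulrV -?sigmap ?(invol_unit HE) // sigmap -mulrA [p * (eps * _)]mulrA.
by rewrite -(epsC HE) -[eps * p * _]mulrA (epsK HE) mulrV.
Qed.

Lemma scale_exists n (h : hform sigma eps n) :
  exists h' : hform sigma1 1 n, scaled h h'.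
Proof.
unshelve eexists (@Form _ _ _ n (fun u w => h u w * p^-1) _ _ _ _) => //.
- by move=> c u u' w /=; rewrite form_linl mulrDl mulrA.
- by move=> c u w w' /=; rewrite form_linr mulrDl -!mulrA sigma_pV.
- move=> u w /=; rewrite mul1r (form_herm h u w) -sigma1E /conj_inv (involM HE).
  rewrite sigmapV mulrA; congr (_ / _); rewrite !mulrA -(epsC HE) -mulrA.
  by rewrite mulrA mulrK.
- move=> w /= hw; apply: (form_nondeg (h := h)) => u.
  by apply: (mulIr (_ : p^-1 \is a GRing.unit)); rewrite ?unitrV // hw mul0r.
Qed.

Lemma unscale_exists n (h' : hform sigma1 1 n) :
  exists h : hform sigma eps n, scaled h h'.
Proof.
unshelve eexists (@Form _ _ _ n (fun u w => h' u w * p) _ _ _ _).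
- by move=> c u u' w /=; rewrite form_linl mulrDl mulrA.
- by move=> c u w w' /=; rewrite form_linr mulrDl -!mulrA sigma_p.
- move=> u w /=; rewrite (form_herm h' u w) mul1r (involM HE) sigmap -sigma_p.
  by rewrite -mulrA (epsK HE).
- move=> w /= hw; apply: (form_nondeg (h := h')) => u.
  by apply: (mulIr up); rewrite hw mul0r.
by move=> u w /=; rewrite mulrK.
Qed.

Lemma scaled_osum n m (h : hform sigma eps n) h' (k : hform sigma eps m) k' :
  scaled h h' -> scaled k k' -> scaled (osum h k) (osum h' k').
Proof. by move=> hh kk u w; rewrite /= /osum_fun hh kk mulrDl. Qed.

Lemma scaled_zerof : scaled (zerof sigma eps) (zerof sigma1 1).
Proof. by move=> u w; rewrite /= /zerof_fun mul0r. Qed.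

Lemma scaled_eq0 n (h : hform sigma eps n) h' u w : scaled h h' ->
  h u w = 0 <-> h' u w = 0.
Proof.
move=> hh; rewrite hh; split=> [->|e]; first by rewrite mul0r.
by apply: (mulIr (_ : p^-1 \is a GRing.unit)); rewrite ?unitrV // e mul0r.
Qed.

Lemma scaled_metabolic n (h : hform sigma eps n) h' : scaled h h' ->
  metabolic h' -> metabolic h.
Proof.
move=> hh [L Ls Lh]; exists L => // w; rewrite Lh.
by split=> hw u /hw /(scaled_eq0 _ _ hh).
Qed.

Lemma scaled_isometric n m (h : hform sigma eps n) h' (k : hform sigma eps m) k' :
  scaled h h' -> scaled k k' -> isometric h' k' -> isometric h k.
Proof.
move=> hh kk [f fb fh]; exists f => // u w.
apply: (mulIr (_ : p^-1 \is a GRing.unit)); first by rewrite unitrV.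
by rewrite -kk -hh.
Qed.

Lemma scaled_witt n m (h : hform sigma eps n) h' (k : hform sigma eps m) k' :
  scaled h h' -> scaled k k' -> witt_rel h' k' -> witt_rel h k.
Proof.
move=> hh kk [a [b [M' [N' [mM mN i]]]]].
have [M sM] := unscale_exists M'; have [N sN] := unscale_exists N'.
exists a, b, M, N; split; try exact: scaled_metabolic mM; try exact: scaled_metabolic mN.
exact: scaled_isometric (scaled_osum hh sM) (scaled_osum kk sN) i.
Qed.

Lemma val_p_gt0 : 0 < v p. Proof. by case: pU. Qed.

(** Springer's argument. Let w = (w0, w1) be a primitive zero. The ramified term
   h1(w1, w1) lies in the ideal of p, so w0 reduces to a zero of g0 and is
   therefore p x with x integral. Then h0(w0, w0) lies in the square of that
   ideal, and dividing by p shows that w1 reduces to a zero of g1. So w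
   reduces to 0, against primitivity. *)
Lemma osum_anisotropic n m (h0 : hform sigma eps n) (g0 : hform rho0 eps0 n)
    (h1 : hform sigma eps m) (h1' : hform sigma1 1 m) (g1 : hform rho1 1 m) :
  lifts v red h0 g0 -> scaled h1 h1' -> lifts v red h1' g1 ->
  ~ isotropic g0 -> ~ isotropic g1 -> ~ isotropic (osum h0 h1).
Proof.
move=> hg0 hh1 hg1 an0 an1 [w0 w0n0].
have [c [c0 iw rw]] := primitive_multiple res divE vM w0n0.
move=> hw0; have : osum h0 h1 (c *: w0) (c *: w0) = 0.
  by rewrite formZl formZr hw0 mul0r mulr0.
move: (c *: w0) iw rw => w iw rw {w0 w0n0 c c0 hw0}.
rewrite /= /osum_fun => hw; case/negP: rw; apply/eqP.
have iu0 : integral v (lsubmx w : 'rV_n) by move=> j; rewrite mxE.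
have iu1 : integral v (rsubmx w : 'rV_m) by move=> j; rewrite mxE.
have [O0 r0] := hg0 _ _ iu0 iu0; have [O1 r1] := hg1 _ _ iu1 iu1.
have Op : val_ring v p by right; apply/ltW/val_p_gt0.
have rp : red p = 0 by apply/(residue_ker res Op); right; exact: val_p_gt0.
have redp d : val_ring v d -> red (d * p) = 0.
  by move=> Od; have [_ ->] := val_ringM res Od Op; rewrite rp mulr0.
have red_p d : val_ring v d -> red (p * d) = 0.
  by move=> Od; have [_ ->] := val_ringM res Op Od; rewrite rp mul0r.
have h1E : h1 (rsubmx w) (rsubmx w) = h1' (rsubmx w) (rsubmx w) * p.
  by rewrite hh1 mulrVK.
move: hw; rewrite h1E => /eqP; rewrite addr_eq0 => /eqP h0E.
have u0 : redv red (lsubmx w) = 0.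
  apply/eqP; apply: contrapT => /negP u0; apply: an0; exists (redv red (lsubmx w)) => //.
  by rewrite -r0 h0E -mulNr redp //; have [] := val_ringN res O1.
have u1 : redv red (rsubmx w) = 0.
  apply/eqP; apply: contrapT => /negP u1; apply: an1; exists (redv red (rsubmx w)) => //.
  rewrite -r1.
  pose x := p^-1 *: lsubmx w.
  have xE : lsubmx w = p *: x by rewrite scalerA mulrV // scale1r.
  have ix : integral v x.
    move=> j; rewrite mxE; have [->|wj] := eqVneq (lsubmx w 0 j) 0.
      by left; rewrite mulr0.
    right; rewrite vM ?(div_invr_neq0 divE) // (vV divE vM) // addrC subr_ge0.
    case: pU => _ _ _; apply=> //.
    rewrite -(red_eq0 res (iu0 j) wj).
    by have /rowP/(_ j) := u0; rewrite !mxE => ->.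
  have [Ox _] := hg0 _ _ ix ix.
  have -> : h1' (rsubmx w) (rsubmx w) = - (p * (h0 x x * eps)).
    apply: (mulIr up); rewrite -[LHS]opprK -h0E xE formZl formZr sigmap.
    by rewrite mulNr !mulrA.
  have [Oe _] := red_eps L0 Ox; rewrite (epsC HE) in Oe.
  have [Ope _] := val_ringM res Op Oe.
  by have [_ ->] := val_ringN res Ope; rewrite red_p // oppr0.
by rewrite -[w]hsubmxK [LHS]map_row_mx [map_mx _ (lsubmx w)]u0 [map_mx _ _]u1 row_mx0.
Qed.

(** The graph of the residue map: the class of h0 + h1 is related to the classes
   of the reductions of h0 and of h1 p^-1. *)
Definition residue_rel (w : witt sigma eps) (z : witt rho0 eps0 * witt rho1 1)
  : Prop :=
  exists n m (h0 : hform sigma eps n) (g0 : hform rho0 eps0 n)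
    (h1 : hform sigma eps m) (h1' : hform sigma1 1 m) (g1 : hform rho1 1 m),
  [/\ lifts v red h0 g0, scaled h1 h1', lifts v red h1' g1,
      w = witt_class (osum h0 h1) & z = (witt_class g0, witt_class g1)].

Lemma residue_relD w w' z z' : residue_rel w z -> residue_rel w' z' ->
  residue_rel (w + w') (z + z').
Proof.
case=> [n [m [h0 [g0 [h1 [h1' [g1 [l0 s1 l1 -> ->]]]]]]]].
case=> [n' [m' [k0 [f0 [k1 [k1' [f1 [l0' s1' l1' -> ->]]]]]]]].
exists _, _, (osum h0 k0), (osum g0 f0), (osum h1 k1), (osum h1' k1'), (osum g1 f1).
split.
- exact: (lifts_osum L0).
- exact: scaled_osum.
- exact: (lifts_osum L1).
- rewrite [LHS](witt_addE (osum h0 h1) (osum k0 k1)).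
  exact/witt_classP/witt_rel_iso/osumACA.
- by congr pair; rewrite -witt_addE.
Qed.

Lemma residue_rel_l0 w : residue_rel w 0 -> w = 0.
Proof.
case=> [n [m [h0 [g0 [h1 [h1' [g1 [l0 s1 l1 -> [e0 e1]]]]]]]]].
have z0 : witt_rel g0 (zerof rho0 eps0) by apply/witt_classP/esym.
have z1 : witt_rel g1 (zerof rho1 1) by apply/witt_classP/esym.
apply: (proj2 (witt_classP _ (zerof sigma eps))).
apply: witt_rel_trans (witt_rel_iso (osum0 _)).
apply: witt_rel_osum; first exact: (lifts_witt_zero L0 l0 z0).
exact: scaled_witt s1 scaled_zerof (lifts_witt_zero L1 l1 z1).
Qed.

(** Replace both reductions by anisotropic ones; then h0 + h1 is anisotropic and
   metabolic, hence 0. *)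
Lemma residue_rel_r0 z : residue_rel 0 z -> z = 0.
Proof.
case=> [n [m [h0 [g0 [h1 [h1' [g1 [l0 s1 l1 e ->]]]]]]]].
have [a [k0 [f0 [lk0 an0 hk0 gf0]]]] := lifts_anisotropic L0 l0.
have [b [k1' [f1 [lk1 an1 hk1 gf1]]]] := lifts_anisotropic L1 l1.
have [k1 s1'] := unscale_exists k1'.
have kz : witt_rel (osum k0 k1) (zerof sigma eps).
  apply: (witt_rel_trans (witt_rel_sym _) (_ : witt_rel (osum h0 h1) _)).
    exact: witt_rel_osum hk0 (scaled_witt s1 s1' hk1).
  by apply/witt_classP/esym.
have an := osum_anisotropic lk0 s1' lk1 an0 an1.
have /eqP := anisotropic_metabolic an (witt_zero_metabolic HE kz).
rewrite addn_eq0 => /andP[/eqP a0 /eqP b0].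
congr pair; apply/witt_classP; first exact: witt_rel_trans gf0 (witt_rank0 _ a0).
exact: witt_rel_trans gf1 (witt_rank0 _ b0).
Qed.

Lemma residue_rel_pair n m (h0 : hform sigma eps n) (h1 : hform sigma eps m) u w :
  larmour_pair v p h0 h1 u w ->
  exists (g0 : hform rho0 eps0 n) (g1 : hform rho1 1 m),
    [/\ diagonal g0 (fun i => red (u i)), diagonal g1 (fun i => red (w i / p))
      & residue_rel (witt_class (osum h0 h1)) (witt_class g0, witt_class g1)].
Proof.
case=> h0u vu h1w vw.
have u_unit i : val_ring v (u i) /\ red (u i) != 0.
  by apply: (val_unit res) => //; have [] := diagonalP HE h0u i.
have [|||k0 [g0 [k0u g0u kg0]]] := lifts_diagonal_ex L0 (d := u).
- by move=> i; have [] := diagonalP HE h0u i.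
- by move=> i; have [] := u_unit i.
- by move=> i; have [] := u_unit i.
have l0 : lifts v red h0 g0.
  by move=> x y ix iy; rewrite h0u -k0u; apply: kg0.
have [h1' s1] := scale_exists h1.
have h1'w : diagonal h1' (fun i => w i / p).
  move=> x y; rewrite s1 h1w mulr_suml; apply: eq_bigr => i _.
  by rewrite -!mulrA sigma_pV.
have w_unit i : val_ring v (w i / p) /\ red (w i / p) != 0.
  have [_ wi0] := diagonalP (ld_source L1) h1'w i.
  apply: (val_unit res) => //; have [_ w0] := diagonalP HE h1w i.
  by rewrite vM ?(div_invr_neq0 divE) // (vV divE vM) // vw subrr.
have [|||k1 [g1 [k1w g1w kg1]]] := lifts_diagonal_ex L1 (d := fun i => w i / p).
- by move=> i; have [] := diagonalP (ld_source L1) h1'w i.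
- by move=> i; have [] := w_unit i.
- by move=> i; have [] := w_unit i.
have l1 : lifts v red h1' g1.
  by move=> x y ix iy; rewrite h1'w -k1w; apply: kg1.
exists g0, g1; split=> //.
by exists n, m, h0, g0, h1, h1', g1.
Qed.

(** Diagonalize, and multiply each entry d to c d sigma(c) of valuation 0 or v(p). *)
Lemma larmour_decompose :
  (forall d, d != 0 -> sigma d = eps * d ->
     exists2 c, c != 0 & v (c * d * sigma c) = 0 \/ v (c * d * sigma c) = v p) ->
  larmour_decomposable v sigma eps p.
Proof.
move=> norm n h; have [k [d [kd hk]]] := diagonalize HE h.
suff [a [b [h0 [h1 [u [w [huw kh]]]]]]] :
  exists a b (h0 : hform sigma eps a) (h1 : hform sigma eps b) u w,
    larmour_pair v p h0 h1 u w /\ isometric k (osum h0 h1).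
  exists a, b, h0, h1, u, w; split=> //; exact: isometric_trans hk kh.
elim: n {h hk} k d kd => [|n IH] k d kd.
  exists 0%N, 0%N, (zerof sigma eps), (zerof sigma eps), (fun=> 0), (fun=> 0).
  split; last first.
    apply: isometric_trans (isometric_sym (osum0 _)).
    apply: (@isometricI _ _ _ _ _ _ _ id id) => // x y.
    by rewrite [x]thinmx0 !form0l.
  by split=> [x y|[]|x y|[]] //; rewrite big_ord0.
have dE := diagonalP HE kd.
have [c c0 vc] := norm _ (proj2 (dE ord0)) (proj1 (dE ord0)).
have [||k1 k1d] := @diagonal_ex _ _ _ HE n (fun i => d (lift ord0 i)).
- by move=> i; have [] := dE (lift ord0 i).
- by move=> i; have [] := dE (lift ord0 i).
have [||a ad] := @diagonal_ex _ _ _ HE 1 (fun=> d ord0).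
- by move=> _; have [] := dE ord0.
- by move=> _; have [] := dE ord0.
have [||a' a'd] := @diagonal_ex _ _ _ HE 1 (fun=> c * d ord0 * sigma c).
- move=> _; rewrite !(involM HE) (involK HE) (proj1 (dE ord0)) !mulrA.
  by rewrite (epsC HE c).
- move=> _; rewrite !(div_mulf_neq0 divE) ?(proj2 (dE ord0)) //.
  by apply: contra_neq c0 => sc; rewrite -[c](involK HE) sc raddf0.
have kk : isometric k (osum a' k1).
  apply: (@isometric_trans _ _ _ _ _ _ _ (osum a k1)).
    apply: (@isometricI _ _ _ _ _ _ _ id id) => // x y.
    rewrite kd /= /osum_fun ad k1d big_ord1 big_ord_recl; congr (_ + _).
      by rewrite !mxE; congr (x _ _ * _ * sigma (y _ _)); apply: val_inj.
    apply: eq_bigr => i _; rewrite !mxE.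
    by congr (x _ _ * _ * sigma (y _ _)); apply: val_inj.
  apply: osum_iso; last exact: isometric_refl.
  exact: isometric_sym (diagonal_scale HE c0 ad a'd).
have [r [s [h0 [h1 [u [w [[hu vu hw vw] k1h]]]]]]] := IH k1 _ k1d.
have kI : isometric k (osum a' (osum h0 h1)).
  exact: isometric_trans kk (osum_iso (isometric_refl _) k1h).
case: vc => vc.
  exists _, s, (osum a' h0), h1, (split_fun (fun=> c * d ord0 * sigma c) u), w.
  split; last exact: isometric_trans kI (osumA _ _ _).
  split=> //; first exact: diagonal_osum.
  by move=> i; rewrite /split_fun; case: splitP.
exists r, _, h0, (osum a' h1), u, (split_fun (fun=> c * d ord0 * sigma c) w).
split.
  split=> //; first exact: diagonal_osum.
  by move=> i; rewrite /split_fun; case: splitP.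
apply: (isometric_trans kI); apply: (isometric_trans (osumA _ _ _)).
apply: (isometric_trans (osum_iso (osumC _ _) (isometric_refl _))).
exact: isometric_sym (osumA _ _ _).
Qed.

Theorem larmour_isomorphism : larmour_decomposable v sigma eps p ->
  exists del : {additive witt sigma eps -> (witt rho0 eps0 * witt rho1 1)%type},
    larmour_residue v red p del /\ bijective del.
Proof.
move=> dec; have [||del [bdel dR]] := 
  additive_bijection residue_relD _ _ residue_rel_l0 residue_rel_r0.
- elim/witt_classW=> n h.
  have [a [b [h0 [h1 [u [w [hp hh]]]]]]] := dec n h.
  have [g0 [g1 [_ _ R]]] := residue_rel_pair hp.
  exists (witt_class g0, witt_class g1).
  suff -> : witt_class h = witt_class (osum h0 h1) by [].
  exact/witt_classP/witt_rel_iso.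
- case; elim/witt_classW=> n g0; elim/witt_classW=> m g1.
  have [h0 [k0 [l0 i0]]] := lifts_exists L0 g0.
  have [h1' [k1 [l1 i1]]] := lifts_exists L1 g1.
  have [h1 s1] := unscale_exists h1'.
  exists (witt_class (osum h0 h1)), n, m, h0, k0, h1, h1', k1; split=> //.
  by congr pair; apply/witt_classP/witt_rel_iso.
exists del; split=> // n m h0 h1 u w hp.
have [g0 [g1 [d0 d1 R]]] := residue_rel_pair hp.
by exists g0, g1; split=> //; apply: dR.
Qed.

End Larmour.

(** * Square roots in a complete discretely valued field *)

Section ValuedField.
Variables (K : fieldType) (nu : K -> int).
Hypothesis nu_cdv : complete_discrete_valuation nu.

(** Zero has infinite valuation; the value of nu at 0 carries no meaning. *)
Definition nu_ge (N : int) (d : K) : Prop := d = 0 \/ N <= nu d.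

Lemma nuM c d : c != 0 -> d != 0 -> nu (c * d) = nu c + nu d.
Proof. exact: (cdv_mul nu_cdv). Qed.
Let divK (d : K) : d != 0 -> d \is a GRing.unit.
Proof. by rewrite unitfE. Qed.
Lemma nuV d : d != 0 -> nu d^-1 = - nu d. Proof. exact: (vV divK nuM). Qed.

Lemma nu_ge_le N M d : N <= M -> nu_ge M d -> nu_ge N d.
Proof. by move=> NM [->|Md]; [left|right; apply: le_trans Md]. Qed.
Lemma nu_geN N d : nu_ge N d -> nu_ge N (- d).
Proof.
have [->|d0] := eqVneq d 0; first by rewrite oppr0.
by case=> [/eqP|Nd]; [rewrite (negbTE d0)|right; rewrite (vN nuM)].
Qed.
Lemma nu_geD N c d : nu_ge N c -> nu_ge N d -> nu_ge N (c + d).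
Proof.
have [->|c0] := eqVneq c 0; first by rewrite add0r.
have [->|d0] := eqVneq d 0; first by rewrite addr0.
case=> [/eqP|Nc]; first by rewrite (negbTE c0).
case=> [/eqP|Nd]; first by rewrite (negbTE d0).
have [->|cd0] := eqVneq (c + d) 0; first by left.
right; apply: le_trans (cdv_add nu_cdv c0 d0 cd0).
by rewrite le_min Nc.
Qed.
Lemma nu_geM N M c d : nu_ge N c -> nu_ge M d -> nu_ge (N + M) (c * d).
Proof.
have [->|c0] := eqVneq c 0; first by left; rewrite mul0r.
have [->|d0] := eqVneq d 0; first by left; rewrite mulr0.
case=> [/eqP|Nc]; first by rewrite (negbTE c0).
case=> [/eqP|Nd]; first by rewrite (negbTE d0).
by right; rewrite nuM // lerD.
Qed.
Lemma nu_geB N c d : nu_ge N c -> nu_ge N d -> nu_ge N (c - d).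
Proof. by move=> Nc Nd; apply/nu_geD/nu_geN. Qed.
Lemma nu_ge_all0 d : (forall n : nat, nu_ge n%:Z d) -> d = 0.
Proof.
move=> dn; apply/eqP; apply: contrapT => /negP d0.
have [/eqP|] := dn `|nu d|.+1%N; first by rewrite (negbTE d0).
rewrite leNgt => /negP; apply.
by rewrite (le_lt_trans (ler_norm _)) // -abszE ltz_nat.
Qed.

(** The iteration s' = s - (s^2 - x) / 2 started at 1 multiplies the error
   s^2 - x by (s^2 - x) / 4 - (s - 1), which lies in the maximal ideal. *)
Lemma hensel_sqrt x : nu 2%:R = 0 -> (2%:R : K) != 0 -> nu_ge 1 (x - 1) ->
  exists2 y, y ^+ 2 = x & nu_ge 1 (y - 1).
Proof.
move=> nu2 two x1; pose s := fix s n : K :=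
  if n is m.+1 then s m - (s m ^+ 2 - x) / 2%:R else 1.
have h2 : nu_ge 0 2%:R^-1 by right; rewrite nuV // nu2.
have sS n : s n.+1 = s n - (s n ^+ 2 - x) / 2%:R by [].
have inv n : nu_ge 1 (s n - 1) /\ nu_ge n.+1%:Z (s n ^+ 2 - x).
  elim: n => [|n [IH1 IH2]].
    by split; [left; rewrite subrr|rewrite expr1n -opprB; apply: nu_geN].
  have eh : nu_ge n.+1%:Z ((s n ^+ 2 - x) / 2%:R).
    by rewrite -[n.+1%:Z]addr0; apply: nu_geM.
  have eh1 : nu_ge 1 ((s n ^+ 2 - x) / 2%:R) by apply: nu_ge_le eh.
  split; first by rewrite sS addrAC; apply: nu_geB.
  have -> : s n.+1 ^+ 2 - x =
      (s n ^+ 2 - x) * ((s n ^+ 2 - x) / 2%:R / 2%:R - (s n - 1)).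
    by rewrite sS; field.
  have -> : n.+2%:Z = n.+1%:Z + 1 by rewrite -PoszD addn1.
  apply: nu_geM => //; apply: nu_geB => //.
  by rewrite -[X in nu_ge X]addr0; apply: nu_geM.
have step i j : (i <= j)%N -> nu_ge i%:Z (s i - s j).
  move=> /subnKC <-; elim: (j - i)%N => [|m IH]; first by left; rewrite addn0 subrr.
  rewrite addnS sS opprB addrCA; apply: nu_geD => //.
  have [_ e] := inv (i + m)%N; rewrite -[i%:Z]addr0; apply: nu_geM => //.
  by apply: nu_ge_le e; rewrite lez_nat -addnS leq_addr.
have [N|l ll] := cdv_complete nu_cdv (s := s).
  exists `|N|%N => i j Ni Nj.
  have b t : (`|N| <= t)%N -> N <= t%:Z.
    by move=> Nt; rewrite (le_trans (ler_norm _)) // -abszE lez_nat.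
  have [ij|/ltnW ji] := leqP i j.
    exact: nu_ge_le (b _ Ni) (step _ _ ij).
  by rewrite -opprB; apply/nu_geN/(nu_ge_le (b _ Nj))/step.
have s0 i : nu_ge 0 (s i).
  rewrite -[s i](subrK 1); apply: nu_geD; first by apply: nu_ge_le (proj1 (inv i)).
  by right; rewrite (v1 nuM).
exists l.
  apply/eqP; rewrite -subr_eq0; apply/eqP/nu_ge_all0 => n.
  have [M lM] := ll n%:Z; pose i := maxn M n.
  have li := lM i (leq_maxl _ _); rewrite -/(nu_ge _ _) in li.
  have -> : l ^+ 2 - x = (s i ^+ 2 - x) - (s i - l) * (s i + s i - (s i - l)).
    by ring.
  apply: nu_geB.
    by apply: nu_ge_le (proj2 (inv i)); rewrite lez_nat ltnW // ltnS leq_maxr.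
  rewrite -[n%:Z]addr0; apply: nu_geM => //.
  by apply: nu_geB; [exact: nu_geD|apply: nu_ge_le li].
have [M lM] := ll 1; have li := lM M (leqnn _); rewrite -/(nu_ge _ _) in li.
have -> : l - 1 = (s M - 1) - (s M - l) by ring.
by apply: nu_geB => //; case: (inv M).
Qed.

Lemma nu_surj (unif : K) (z : int) : unif != 0 -> nu unif = 1 ->
  exists2 c, c != 0 & nu c = z.
Proof.
move=> u0 u1; have nuX n : nu (unif ^+ n) = n%:Z.
  elim: n => [|n IH]; first by rewrite expr0 (v1 nuM).
  by rewrite exprS nuM ?expf_neq0 // IH u1 -PoszD.
case: z => n; first by exists (unif ^+ n); rewrite ?expf_neq0.
by exists (unif ^+ n.+1)^-1; rewrite ?invr_eq0 ?expf_neq0 // nuV ?expf_neq0 // nuX NegzE.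
Qed.

End ValuedField.

(** * Quaternion algebras *)

Section Quaternions.
Variables (K : fieldType) (a b : K).
Local Notation H := (quat a b).

Lemma quat_unitE (d : H) : (d \is a GRing.unit) = (Nrd d != 0). Proof. by []. Qed.

Lemma quat_x_unit : a != 0 -> quat_x a b \is a GRing.unit.
Proof.
by rewrite quat_unitE /Nrd /= !expr0n /= !(mulr0, expr1n, mulr1, sub0r, subr0, addr0) oppr_eq0.
Qed.

Lemma tau_xE (d : H) : a != 0 ->
  tau_x a b d = Quat (q0 d) (- q1 d) (q2 d) (q3 d).
Proof.
move=> /quat_x_unit ux.
apply: (mulIr ux); rewrite /tau_x /= /conj_inv mulrVK //.
by apply: quat_eq => /=; ring.
Qed.

Lemma quat_two_neq0 : (2%:R : K) != 0 -> (2%:R : H) != 0.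
Proof. by apply: contra_neq => /(congr1 (@q0 K a b)). Qed.

Lemma tau_x_hermitian : (2%:R : K) != 0 -> a != 0 ->
  (forall d : H, d != 0 -> d \is a GRing.unit) -> hermitian_datum (tau_x a b) (-1).
Proof.
move=> two a0 div; split=> //.
- apply: conj_inv_involution; [exact: quat_tau_involution|exact: quat_x_unit|].
  by right; apply: quat_eq => /=; ring.
- by right.
- exact: quat_two_neq0.
exists (quat_x a b); rewrite tau_xE // mulN1r; apply/eqP => /(congr1 (@q1 K a b)) /=.
by rewrite opprK -mulr2n => /eqP; rewrite (negbTE two).
Qed.

Lemma quat_tau_hermitian : (2%:R : K) != 0 ->
  (forall d : H, d != 0 -> d \is a GRing.unit) -> hermitian_datum (quat_tau a b) 1.
Proof.
move=> two div; split=> //.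
- exact: quat_tau_involution.
- by left.
- exact: quat_two_neq0.
exists 1; rewrite mul1r; apply/eqP => /(congr1 (@q0 K a b)) /=.
by rewrite -mulr2n => /eqP; rewrite (negbTE two).
Qed.

Lemma NrdZ (c : K) (d : H) : Nrd (c *: d) = c ^+ 2 * Nrd d.
Proof. by rewrite /Nrd /=; ring. Qed.

Lemma quat_square (t : H) : t * t = (q0 t + q0 t) *: t - (Nrd t)%:A.
Proof. by apply: quat_eq; rewrite /Nrd /=; ring. Qed.

(** In the commutative field K(t), with N = Nrd(t) = s^2 and T = Trd(t), one has
   (t + s)^2 = t^2 + 2 s t + N = (T + 2 s) t. *)
Lemma quat_sqrt (t : H) (s r : K) : s ^+ 2 = Nrd t ->
  r ^+ 2 = q0 t + q0 t + (s + s) -> r != 0 ->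
  let c := r^-1 *: (t + s%:A) in c * c = t.
Proof.
move=> sN rE r0 c; rewrite /c -scalerAl -scalerAr scalerA -invfM -expr2.
have -> : (t + s%:A) * (t + s%:A) = r ^+ 2 *: t.
  rewrite mulrDl !mulrDr quat_square -sN rE.
  by apply: quat_eq => /=; ring.
by rewrite scalerA mulVf ?scale1r ?expf_neq0.
Qed.

End Quaternions.

(** * Unramified quaternion division algebras *)

Section UnramifiedQuaternions.
Variables (K : fieldType) (nu : K -> int) (k : fieldType) (res : K -> k).
Variables (unif a b : K).
Hypothesis nu_cdv : complete_discrete_valuation nu.
Hypothesis res_field : residue_map nu res.
Hypothesis char_k : 2%N \notin [pchar k].
Hypothesis unif_neq0 : unif != 0.
Hypothesis nu_unif : nu unif = 1.
Hypothesis a_neq0 : a != 0.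
Hypothesis nu_a : nu a = 0.
Hypothesis b_neq0 : b != 0.
Hypothesis nu_b : nu b = 0.
Hypothesis D_division : forall d : quat a b, d != 0 -> d \is a GRing.unit.
Local Notation H := (quat a b).
Local Notation Hk := (quat (res a) (res b)).
Local Notation O := (val_ring nu).
Local Notation red := (@quat_red K k res a b).
Local Notation v := (@nuD K nu a b).

Let nuM := nuM nu_cdv.
Let divK (d : K) : d != 0 -> d \is a GRing.unit.
Proof. by rewrite unitfE. Qed.
Let res0 : res 0 = 0. Proof. exact: red0 res_field. Qed.
Let res1 : res 1 = 1. Proof. exact: residue_1 res_field. Qed.
Let Oa : O a. Proof. by right; rewrite nu_a. Qed.
Let Ob : O b. Proof. by right; rewrite nu_b. Qed.
Let O1 : O 1. Proof. exact: (val_ring1 nuM). Qed.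

Lemma res_neq0 d : d != 0 -> nu d = 0 -> res d != 0.
Proof. by move=> d0 /(val_unit res_field d0) []. Qed.

Lemma two_residue_neq0 : (2%:R : k) != 0.
Proof. by move: char_k; rewrite inE /=. Qed.

Let O2 : O 2%:R /\ res 2%:R = 2%:R.
Proof. by have [? e] := val_ringD res_field O1 O1; rewrite mulr2n e res1. Qed.

Lemma two_unit : (2%:R : K) != 0 /\ nu 2%:R = 0.
Proof.
have [O2' r2] := O2.
by have [|? ? _ _] := red_unit res_field divK nuM O2'; first by rewrite r2 two_residue_neq0.
Qed.

(** The order spanned by 1, x, y, z over the valuation ring, which turns out to be
   the valuation ring of D. *)
Definition integral_quat (d : H) : Prop := [/\ O (q0 d), O (q1 d), O (q2 d) & O (q3 d)].

Lemma integral_quatB c d : integral_quat c -> integral_quat d ->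
  integral_quat (c - d) /\ red (c - d) = red c - red d.
Proof.
move=> [c0 c1 c2 c3] [d0 d1 d2 d3].
have [? r0] := val_ringB res_field c0 d0; have [? r1] := val_ringB res_field c1 d1.
have [? r2] := val_ringB res_field c2 d2; have [? r3] := val_ringB res_field c3 d3.
by split=> //; apply: quat_eq.
Qed.

Let M c d : O c -> O d -> O (c * d) /\ res (c * d) = res c * res d.
Proof. exact: val_ringM. Qed.
Let A c d : O c -> O d -> O (c + d) /\ res (c + d) = res c + res d.
Proof. exact: val_ringD. Qed.
Let B c d : O c -> O d -> O (c - d) /\ res (c - d) = res c - res d.
Proof. exact: val_ringB. Qed.

(** The graph of reduction on the valuation ring of K; being closed under ring
   operations, it evaluates reductions of polynomial expressions. *)
Definition tracks (c : K) (e : k) := O c /\ res c = e.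
Let tM c d e f : tracks c e -> tracks d f -> tracks (c * d) (e * f).
Proof. by move=> [Oc <-] [Od <-]; apply: M. Qed.
Let tD c d e f : tracks c e -> tracks d f -> tracks (c + d) (e + f).
Proof. by move=> [Oc <-] [Od <-]; apply: A. Qed.
Let tN c e : tracks c e -> tracks (- c) (- e).
Proof. by move=> [Oc <-]; apply: val_ringN. Qed.
Let tB c d e f : tracks c e -> tracks d f -> tracks (c - d) (e - f).
Proof. by move=> ? ?; apply/tD/tN. Qed.
Let t_a : tracks a (res a). Proof. by []. Qed.
Let t_b : tracks b (res b). Proof. by []. Qed.
Ltac track := repeat (first [assumption | apply: t_a | apply: t_b
  | apply: tD | apply: tN | apply: tM]).

Lemma integral_quatM c d : integral_quat c -> integral_quat d ->
  integral_quat (c * d) /\ red (c * d) = red c * red d.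
Proof.
move=> [c0 c1 c2 c3] [d0 d1 d2 d3].
have T x : O x -> tracks x (res x) by [].
move: (T _ c0) (T _ c1) (T _ c2) (T _ c3) (T _ d0) (T _ d1) (T _ d2) (T _ d3).
move=> {c0 c1 c2 c3 d0 d1 d2 d3} c0 c1 c2 c3 d0 d1 d2 d3.
have [O0 r0] : tracks (q0 (c * d)) (q0 (red c * red d)) by rewrite /=; track.
have [O1' r1] : tracks (q1 (c * d)) (q1 (red c * red d)) by rewrite /=; track.
have [O2' r2] : tracks (q2 (c * d)) (q2 (red c * red d)) by rewrite /=; track.
have [O3' r3] : tracks (q3 (c * d)) (q3 (red c * red d)) by rewrite /=; track.
by split=> //; apply: quat_eq.
Qed.

Lemma integral_quat_Nrd d : integral_quat d -> tracks (Nrd d) (Nrd (red d)).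
Proof.
move=> [d0 d1 d2 d3]; have T x : O x -> tracks x (res x) by [].
move: (T _ d0) (T _ d1) (T _ d2) (T _ d3) => {d0 d1 d2 d3} d0 d1 d2 d3.
rewrite /Nrd !expr2 /=; track.
Qed.

Lemma integral_quat_surj (e : Hk) : exists2 d, integral_quat d & red d = e.
Proof.
case: e => e0 e1 e2 e3.
have [d0 ? <-] := residue_surj res_field e0; have [d1 ? <-] := residue_surj res_field e1.
have [d2 ? <-] := residue_surj res_field e2; have [d3 ? <-] := residue_surj res_field e3.
by exists (Quat d0 d1 d2 d3).
Qed.

Lemma hensel_sqrt_res x : O x -> res x = 1 -> exists y, [/\ y ^+ 2 = x, O y & res y = 1].
Proof.
move=> Ox rx; have [two nu2] := two_unit.
have ge1 d : O d -> res d = 0 -> nu_ge nu 1 d.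
  by move=> Od /(residue_ker res_field Od)[->|nd]; [left|right].
have [O' r'] := B Ox O1; rewrite rx res1 subrr in r'.
have [y yx y1] := hensel_sqrt nu_cdv nu2 two (ge1 _ O' r').
have Oy1 : O (y - 1) by case: y1 => y1; [left|right; apply: le_trans y1].
have ry1 : res (y - 1) = 0.
  by apply/(residue_ker res_field Oy1); case: y1 => y1; [left|right].
by exists y; have [] := A Oy1 O1; rewrite subrK ry1 res1 add0r.
Qed.

(** The equation is q'^2 = q^2 (1 - N / (c q^2)), where the second factor is a square. *)
Lemma solve_square (c q N : K) : O c -> res c != 0 -> O q -> res q != 0 ->
  O N -> res N = 0 -> exists2 q', q' != 0 & c * q' ^+ 2 = c * q ^+ 2 - N.
Proof.
move=> Oc rc Oq' rq ON rN.
have [c0 _ OcV _] := red_unit res_field divK nuM Oc rc.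
have [nq0 _ OqV _] := red_unit res_field divK nuM Oq' rq.
have [Ox rx] : tracks (1 - N * (c^-1 * (q^-1 * q^-1))) 1.
  rewrite -[X in tracks _ X]subr0 -[X in tracks _ (_ - X)](mul0r (res (c^-1 * (q^-1 * q^-1)))).
  have [Oqq _] := M OqV OqV; have [Ocq _] := M OcV Oqq.
  by apply: tB; [split|apply: tM].
have [y [yE _ ry]] := hensel_sqrt_res Ox rx.
have y0 : y != 0 by apply: contra_eq_neq ry => ->; rewrite res0 eq_sym oner_neq0.
exists (q * y); first by rewrite mulf_neq0.
by rewrite exprMn yE; field; rewrite c0 nq0.
Qed.

(** A nontrivial zero of the reduced norm form lifts to an element d with Nrd(d) in
   the maximal ideal; changing one coordinate of d whose reduction is nonzero
   makes Nrd(d) = 0, against D being a division algebra. *)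
Lemma residue_algebra_division (e : Hk) : e != 0 -> e \is a GRing.unit.
Proof.
move=> e0; rewrite quat_unitE; apply: contraNneq e0 => Ne.
have [d Od rd] := integral_quat_surj e; have [ON rN] := integral_quat_Nrd Od.
rewrite rd Ne in rN; rewrite -{e}rd in Ne *.
have anis (d' : H) : Nrd d' = 0 -> d' = 0.
  by move=> Nd; apply/eqP; apply: contraTT isT => /D_division; rewrite quat_unitE Nd eqxx.
have ra := res_neq0 a_neq0 nu_a; have rb := res_neq0 b_neq0 nu_b.
case: Od => d0 d1 d2 d3; apply/eqP; apply: quat_eq => /=; apply/eqP; apply: contrapT => /negP r.
- have [|q' q'0 qE] := solve_square O1 _ d0 r ON rN; first by rewrite res1 oner_neq0.
  rewrite !mul1r in qE.
  have e0 : Nrd (Quat q' (q1 d) (q2 d) (q3 d) : H) = 0 by rewrite /Nrd /= qE /Nrd; ring.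
  by have /(congr1 (@q0 K a b))/eqP := anis _ e0; rewrite /= (negbTE q'0).
- have [ONa rNa] := tN (conj Oa erefl : tracks a (res a)).
  have [|q' q'0 qE] := solve_square ONa _ d1 r ON rN; first by rewrite rNa oppr_eq0.
  have e0 : Nrd (Quat (q0 d) q' (q2 d) (q3 d) : H) = 0 by rewrite /Nrd /= -mulNr qE /Nrd; ring.
  by have /(congr1 (@q1 K a b))/eqP := anis _ e0; rewrite /= (negbTE q'0).
- have [ONa rNa] := tN (conj Ob erefl : tracks b (res b)).
  have [|q' q'0 qE] := solve_square ONa _ d2 r ON rN; first by rewrite rNa oppr_eq0.
  have e0 : Nrd (Quat (q0 d) (q1 d) q' (q3 d) : H) = 0 by rewrite /Nrd /= -[- (b * _)]mulNr qE /Nrd; ring.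
  by have /(congr1 (@q2 K a b))/eqP := anis _ e0; rewrite /= (negbTE q'0).
have [Oab rab] := M Oa Ob.
have [|q' q'0 qE] := solve_square Oab _ d3 r ON rN; first by rewrite rab mulf_neq0.
have e0 : Nrd (Quat (q0 d) (q1 d) (q2 d) q' : H) = 0 by rewrite /Nrd /= qE /Nrd; ring.
by have /(congr1 (@q3 K a b))/eqP := anis _ e0; rewrite /= (negbTE q'0).
Qed.

Lemma Nrd_neq0 (d : H) : d != 0 -> Nrd d != 0.
Proof. by move/D_division. Qed.

Lemma nuDM c d : c != 0 -> d != 0 -> v (c * d) = v c + v d.
Proof.
move=> c0 d0; rewrite /nuD Nrd_mul nuM ?Nrd_neq0 //.
by rewrite intrD mulrDl.
Qed.

Lemma nuDZ (c : K) d : c != 0 -> d != 0 -> v (c *: d) = (nu c)%:~R + v d.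
Proof.
move=> c0 d0; rewrite /nuD NrdZ nuM ?expf_neq0 ?Nrd_neq0 // expr2 nuM //.
by rewrite !intrD; field.
Qed.

(** As the reduced norm form is anisotropic, Nrd of a primitive element is a unit;
   hence nuD is the minimum of the valuations of the coordinates. *)
Lemma quat_primitive (d : H) : d != 0 -> exists c,
  [/\ c != 0, integral_quat (c *: d), red (c *: d) != 0 & v d = (- nu c)%:~R].
Proof.
move=> d0; pose u : 'rV[K]_4 := \row_(i < 4) [:: q0 d; q1 d; q2 d; q3 d]`_i.
have u0 : u != 0.
  apply: contra_neq d0 => /rowP u0; apply: quat_eq => /=.
  - by have := u0 0; rewrite !mxE.
  - by have := u0 1; rewrite !mxE.
  - by have := u0 2%:R; rewrite !mxE.
  - by have := u0 3%:R; rewrite !mxE.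
have [c [c0 iu ru]] := primitive_multiple res_field divK nuM u0.
have Ocd : integral_quat (c *: d).
  split; [have := iu 0|have := iu 1|have := iu 2%:R|have := iu 3%:R];
  by rewrite !mxE.
have rcd : red (c *: d) != 0.
  apply: contra_neq ru => rcd; apply/rowP => i; rewrite !mxE.
  have := (congr1 (@q0 _ _ _) rcd, congr1 (@q1 _ _ _) rcd, congr1 (@q2 _ _ _) rcd,
           congr1 (@q3 _ _ _) rcd) => /= -[[[e0 e1] e2] e3].
  by case: i => -[|[|[|[|//]]]] i.
exists c; split=> //.
have [ON rN] := integral_quat_Nrd Ocd.
have [_ vN0 _ _] := red_unit res_field divK nuM ON
  (eq_ind_r (fun x => x != 0) (residue_algebra_division rcd) rN).
have : v (c *: d) = 0 by rewrite /nuD vN0 mul0r.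
by rewrite nuDZ // => /eqP; rewrite addrC addr_eq0 mulrNz => /eqP.
Qed.

Lemma integral_quatZ (c : K) d : O c -> integral_quat d ->
  integral_quat (c *: d) /\ red (c *: d) = res c *: red d.
Proof.
move=> Oc [d0 d1 d2 d3].
have [? r0] := M Oc d0; have [? r1] := M Oc d1.
have [? r2] := M Oc d2; have [? r3] := M Oc d3.
by split=> //; apply: quat_eq.
Qed.

Lemma val_ringP (d : H) : val_ring v d <-> integral_quat d.
Proof.
have [->|d0] := eqVneq d 0; first by split=> _; [split|]; left.
have [c [c0 Ocd rcd vd]] := quat_primitive d0.
have dE : d = c^-1 *: (c *: d) by rewrite scalerA mulVf // scale1r.
split=> [[/eqP|]|Od]; first by rewrite (negbTE d0).
  rewrite vd ler0z oppr_ge0 => nc; rewrite dE.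
  have OcV : O c^-1 by right; rewrite (nuV nu_cdv) // oppr_ge0.
  by have [] := integral_quatZ OcV Ocd.
right; rewrite vd ler0z oppr_ge0 leNgt; apply: contra rcd => nc.
have Oc : O c by right; apply: ltW.
have [_ ->] := integral_quatZ Oc Od.
by have /eqP -> : res c == 0; rewrite ?scale0r ?eqxx // (red_eq0 res_field).
Qed.

Lemma val_idealP (d : H) : integral_quat d -> (red d = 0 <-> val_ideal v d).
Proof.
have [->|d0] := eqVneq d 0.
  by move=> _; split=> _; [left|apply: quat_eq => /=].
move=> Od; have [c [c0 Ocd rcd vd]] := quat_primitive d0.
have dE : d = c^-1 *: (c *: d) by rewrite scalerA mulVf // scale1r.
have : val_ring v d by apply/val_ringP.
case=> [/eqP|]; first by rewrite (negbTE d0).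
rewrite vd ler0z oppr_ge0 => nc.
have cV0 : c^-1 != 0 by rewrite invr_eq0.
have OcV : O c^-1 by right; rewrite (nuV nu_cdv) // oppr_ge0.
have [_ rdE] := integral_quatZ OcV Ocd; rewrite -dE in rdE; rewrite rdE.
split=> [e|[/eqP|]].
- right; rewrite vd ltr0z -(nuV nu_cdv) // -(red_eq0 res_field) //.
  apply: contraT => rc; case/eqP: rcd.
  by apply: (scalerI rc); rewrite e scaler0.
- by rewrite (negbTE d0).
rewrite vd ltr0z -(nuV nu_cdv) // -(red_eq0 res_field) // => /eqP ->.
by rewrite scale0r.
Qed.

Lemma quat_residue_map : residue_map v red.
Proof.
split.
- by apply: quat_eq => /=.
- move=> c d /val_ringP Oc /val_ringP Od.
  have [? ?] := integral_quatB Oc Od; have [? ?] := integral_quatM Oc Od.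
  by split=> //; apply/val_ringP.
- by move=> d /val_ringP/val_idealP.
by move=> e; have [d Od <-] := integral_quat_surj e; exists d => //; apply/val_ringP.
Qed.

Let ra : res a != 0. Proof. exact: res_neq0. Qed.

Lemma induced_tau_x : induced v red (tau_x a b) (tau_x (res a) (res b)).
Proof.
move=> d /val_ringP Od; rewrite !tau_xE //.
case: (Od) => _ d1 _ _; have [O1' r1] := val_ringN res_field d1.
split; first by apply/val_ringP; case: Od.
by apply: quat_eq => //=.
Qed.

Lemma induced_tau : induced v red (quat_tau a b) (quat_tau (res a) (res b)).
Proof.
move=> d /val_ringP [d0 d1 d2 d3].
have [? r1] := val_ringN res_field d1; have [? r2] := val_ringN res_field d2.
have [? r3] := val_ringN res_field d3.
split; first by apply/val_ringP.
by apply: quat_eq => //=.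
Qed.

(** The reduced norm of t reduces to 1 and its trace to 2, so the two square roots
   needed to form the square root of t in K(t) exist in K. Being a K-linear
   combination of 1 and t, it inherits the relation between t and u. *)
Lemma quat_hensel (rho : {additive H -> H}) (t : H) :
  rho 1 = 1 -> (forall (c : K) d, rho (c *: d) = c *: rho d) ->
  val_ring v t -> red t = 1 ->
  exists2 c, c * c = t & forall u, t * u = u * rho t -> c * u = u * rho c.
Proof.
move=> rho1 rhoZ /val_ringP Ot rt.
have [two _] := two_unit; have [Ott r2] := O2.
have [ON rN] := integral_quat_Nrd Ot; rewrite rt Nrd1 in rN.
have [s [sN Os rs]] := hensel_sqrt_res ON rN.
have Ot0 : O (q0 t) by case: Ot.
have rt0 : res (q0 t) = 1 by have /(congr1 (@q0 _ _ _)) := rt.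
have [_ _ O2V r2V] := red_unit res_field divK nuM Ott (eq_ind_r (fun x => x != 0) two_residue_neq0 r2).
(* 2 y is a square root of Trd(t) + 2 s; Hensel applies as y^2 reduces to 1. *)
have [Ox rx] : tracks ((q0 t + s) * 2%:R^-1) 1.
  have -> : 1 = (1 + 1) * 2%:R^-1 :> k by rewrite -mulr2n mulfV // two_residue_neq0.
  by apply: tM; [apply: tD|split=> //; rewrite r2V r2].
have [y [yE _ ry]] := hensel_sqrt_res Ox rx.
have y0 : y != 0 by apply: contra_eq_neq ry => ->; rewrite res0 eq_sym oner_neq0.
have r0 : y * 2%:R != 0 by rewrite mulf_neq0.
have rE : (y * 2%:R) ^+ 2 = q0 t + q0 t + (s + s).
  by rewrite exprMn yE; field.
exists ((y * 2%:R)^-1 *: (t + s%:A)); first exact: quat_sqrt.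
move=> u tu; rewrite rhoZ (raddfD rho) rhoZ rho1 -scalerAl -scalerAr; congr (_ *: _).
by rewrite mulrDl mulrDr tu -scalerAl -scalerAr mul1r mulr1.
Qed.

Lemma lifting_tau_x : lifting_datum v red (tau_x a b) (-1) (tau_x (res a) (res b)) (-1).
Proof.
have [two _] := two_unit.
split.
- exact: tau_x_hermitian.
- exact: (tau_x_hermitian two_residue_neq0 ra residue_algebra_division).
- exact: quat_residue_map.
- exact: nuDM.
- exact: induced_tau_x.
- by right.
move=> t; apply: (@quat_hensel (tau_x a b) t); first by rewrite tau_xE //; apply: quat_eq => /=; rewrite ?oppr0.
by move=> c d; rewrite !tau_xE //; apply: quat_eq => /=; rewrite ?mulrN.
Qed.

Lemma lifting_tau : lifting_datum v red (quat_tau a b) 1 (quat_tau (res a) (res b)) 1.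
Proof.
have [two _] := two_unit.
split.
- exact: quat_tau_hermitian.
- exact: (quat_tau_hermitian two_residue_neq0 residue_algebra_division).
- exact: quat_residue_map.
- exact: nuDM.
- exact: induced_tau.
- by left.
move=> t; apply: (@quat_hensel (quat_tau a b) t); first by apply: quat_eq => /=; rewrite ?oppr0.
by move=> c d; apply: quat_eq => /=; rewrite ?mulrN.
Qed.

Local Notation p := (unif *: quat_x a b).

Lemma quat_x_neq0 : quat_x a b != 0.
Proof. by apply/eqP => /(congr1 (@q1 _ _ _))/eqP; rewrite /= oner_eq0. Qed.

Lemma nuD_quat_x : v (quat_x a b) = 0.
Proof.
have -> : v (quat_x a b) = (nu (- a))%:~R / 2%:R by congr ((nu _)%:~R / _); rewrite /Nrd /=; ring.
by rewrite (vN nuM) // nu_a mul0r.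
Qed.

Lemma nuD_uniformizer : v p = 1.
Proof. by rewrite nuDZ // ?quat_x_neq0 // nuD_quat_x nu_unif addr0. Qed.

Lemma uniformizer_sym : sym_uniformizer v (tau_x a b) (-1) p.
Proof.
split.
- by rewrite scaler_eq0 negb_or unif_neq0 quat_x_neq0.
- by rewrite tau_xE // mulN1r; apply: quat_eq => /=; rewrite ?mulr0 ?oppr0.
- by rewrite nuD_uniformizer.
move=> d d0; have [c [_ _ _ ->]] := quat_primitive d0.
by rewrite nuD_uniformizer ltr0z ler1z.
Qed.

Lemma conj_inv_uniformizer : conj_inv (tau_x a b) p =1 quat_tau a b.
Proof.
move=> d; have up : p \is a GRing.unit.
  by apply: D_division; case: uniformizer_sym.
apply: (mulIr up); rewrite /conj_inv mulrVK // tau_xE //.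
by apply: quat_eq => /=; ring.
Qed.

(** A scalar c of K multiplies an entry by c^2 and so preserves the parity of its
   valuation, which therefore can be made 0 or 1. *)
Lemma larmour_decomposable_tau_x : larmour_decomposable v (tau_x a b) (-1) p.
Proof.
apply: (larmour_decompose lifting_tau_x) => d d0 _.
have [e [_ _ _ vd]] := quat_primitive d0.
(* With m = nuD(d), multiplying d by c^2 where nu(c) = - (m div 2) leaves m mod 2. *)
pose m := - nu e; have [c c0 nc] := nu_surj nu_cdv (- (m %/ 2)%Z) unif_neq0 nu_unif.
exists c%:A; first by rewrite scaler_eq0 negb_or c0 oner_neq0.
have -> : tau_x a b c%:A = c%:A.
  by rewrite tau_xE //; apply: quat_eq => /=; rewrite ?mulr0 ?oppr0.
rewrite -scalerAl mul1r -scalerAr mulr1 scalerA nuD_uniformizer nuDZ ?mulf_neq0 //.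
rewrite nuM // nc vd.
rewrite -intrD -/m -[1]/(1%:~R).
have -> : - (m %/ 2)%Z - (m %/ 2)%Z + m = (m %% 2)%Z by rewrite {3}(divz_eq m 2); ring.
have : (0 <= (m %% 2)%Z < 2) by rewrite modz_ge0 // ltz_pmod.
by case: (m %% 2)%Z => // -[|[|//]] _; [left|right].
Qed.

End UnramifiedQuaternions.

(** * The residue isomorphism for skew-hermitian forms *)

Theorem mainTheorem9 (K : fieldType) (nu : K -> int) (k : fieldType) (res : K -> k)
    (unif a b : K)
    (nu_cdv : complete_discrete_valuation nu)
    (res_field : residue_map nu res)
    (char_k : 2%N \notin [pchar k])
    (unif_neq0 : unif != 0) (nu_unif : nu unif = 1)
    (a_neq0 : a != 0) (nu_a : nu a = 0)
    (b_neq0 : b != 0) (nu_b : nu b = 0)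
    (D_division : forall d : quat a b, d != 0 -> d \is a GRing.unit) :
  let ab := res a in let bb := res b in
  let v := @nuD K nu a b in
  let red := @quat_red K k res a b in
  let p := unif *: quat_x a b in
  [/\ (* O_D / m_D is the quaternion division algebra (ab, bb / k) *)
      residue_map v red /\
      (forall e : quat ab bb, e != 0 -> e \is a GRing.unit),
      induced v red (tau_x a b) (tau_x ab bb) /\
      induced v red (quat_tau a b) (quat_tau ab bb),
      sym_uniformizer v (tau_x a b) (-1) p /\
      conj_inv (tau_x a b) p =1 quat_tau a b,
      larmour_decomposable v (tau_x a b) (-1) p
    & exists del : {additive witt (tau_x a b) (-1) ->
                     (witt (tau_x ab bb) (-1) * witt (quat_tau ab bb) 1)%type},
      [/\ larmour_residue v red p del,
          bijective del,
          forall alpha : K, alpha != 0 -> nu alpha = 0 ->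
            exists (h : hform (tau_x a b) (-1) 1) (g : hform (tau_x ab bb) (-1) 1),
              [/\ diagonal h (fun=> alpha *: quat_x a b),
                  diagonal g (fun=> res alpha *: quat_x ab bb)
                & (del (witt_class h)).1 = witt_class g]
        & forall alpha : K, alpha != 0 -> nu alpha = 1 ->
            exists (h : hform (tau_x a b) (-1) 1) (g : hform (quat_tau ab bb) 1 1),
              [/\ diagonal h (fun=> alpha *: quat_x a b),
                  diagonal g (fun=> (res (unif^-1 * alpha))%:A)
                & (del (witt_class h)).2 = witt_class g]]].
Proof.
move=> ab bb v red p.
have L0 := lifting_tau_x nu_cdv res_field char_k a_neq0 nu_a b_neq0 nu_b D_division.
have L1 := lifting_tau nu_cdv res_field char_k a_neq0 nu_a b_neq0 nu_b D_division.
have pU := uniformizer_sym nu_cdv res_field char_k unif_neq0 nu_unif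
  a_neq0 nu_a b_neq0 nu_b D_division.
have pE := conj_inv_uniformizer nu_cdv res_field char_k unif_neq0 nu_unif
  a_neq0 nu_a b_neq0 nu_b D_division.
have dec := larmour_decomposable_tau_x nu_cdv res_field char_k unif_neq0 nu_unif
  a_neq0 nu_a b_neq0 nu_b D_division.
have HE := ld_source L0.
split=> //.
- split; first exact: (ld_residue L0).
  exact: (hd_div (ld_target L0)).
- by split; [exact: (ld_induced L0)|exact: (ld_induced L1)].
have [del [delR delB]] := larmour_isomorphism L0 L1 pU pE dec.
exists del; split=> // alpha alpha0 nu_alpha.
  have [||h hd] := @diagonal_ex _ _ _ HE 1 (fun=> alpha *: quat_x a b).
  - by move=> _; rewrite tau_xE // mulN1r; apply: quat_eq => /=; rewrite ?mulr0 ?oppr0.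
  - by move=> _; rewrite scaler_eq0 negb_or alpha0 quat_x_neq0.
  have hp : larmour_pair v p h (zerof (tau_x a b) (-1))
      (fun=> alpha *: quat_x a b) (fun=> 0).
    split=> //.
    - by move=> _; rewrite /v nuDZ ?quat_x_neq0 // nuD_quat_x // nu_alpha.
    - by move=> x y; rewrite big_ord0.
    - by case.
  have [g [g1 [gd _ e]]] := delR _ _ _ _ _ _ hp.
  exists h, g; split=> //.
  - move=> x y; rewrite gd; apply: eq_bigr => i _; congr (_ * _ * _).
    by apply: quat_eq => /=; rewrite ?mulr0 ?mulr1 // (red0 res_field).
  - have -> : witt_class h = witt_class (osum h (zerof _ _)).
      apply/witt_classP/witt_rel_iso/isometric_sym.
      exact: isometric_trans (osumC _ _) (osum0 _).
    by rewrite e.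
have [||h hd] := @diagonal_ex _ _ _ HE 1 (fun=> alpha *: quat_x a b).
- by move=> _; rewrite tau_xE // mulN1r; apply: quat_eq => /=; rewrite ?mulr0 ?oppr0.
- by move=> _; rewrite scaler_eq0 negb_or alpha0 quat_x_neq0.
have hp : larmour_pair v p (zerof (tau_x a b) (-1)) h (fun=> 0)
    (fun=> alpha *: quat_x a b).
  split=> //.
  - by move=> x y; rewrite big_ord0.
  - by case.
  - by move=> _; rewrite /v nuDZ ?quat_x_neq0 // nuD_quat_x // nu_alpha addr0 nuD_uniformizer.
have [g0 [g [_ gd e]]] := delR _ _ _ _ _ _ hp.
exists h, g; split=> //.
- move=> x y; rewrite gd; apply: eq_bigr => i _; congr (_ * _ * _).
  have -> : alpha *: quat_x a b / p = (unif^-1 * alpha)%:A.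
    have up : p \is a GRing.unit by apply: D_division; case: pU.
    by apply: (mulIr up); rewrite mulrVK //; apply: quat_eq => /=; field.
  by apply: quat_eq => /=; rewrite ?mulr0 ?mulr1 // (red0 res_field).
have -> : witt_class h = witt_class (osum (zerof _ _) h).
  exact/witt_classP/witt_rel_iso/isometric_sym/osum0.
by rewrite e.
Qed.
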